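(* Let $(M^m,g)$ be a Riemannian manifold, $(N^{2n},J,h)$ a Kähler manifold of real dimension $2n$, $V$ a smooth vector field on $M$, and $\varphi:M\to N$ a pseudo-horizontally homothetic (PHH), $V$-harmonic submersion. If $P^{2p}\subset N^{2n}$ is a complex submanifold of $N$ (of real dimension $2p$), then $\varphi^{-1}(P)\subset M$ is a $V$-minimal submanifold of $M$.
   Context: $V$-harmonic maps: for a smooth map $\varphi:(M,g)\to(N,h)$, the tension field is $\tau(\varphi)=\mathrm{trace}_g\nabla d\varphi\in\Gamma(\varphi^{-1}TN)$, and the $V$-tension field is $\tau_V(\varphi)=\tau(\varphi)+d\varphi(V)$. The map $\varphi$ is $V$-harmonic if $\tau_V(\varphi)=0$. PHWC and PHH maps: for $x\in M$, let $d\varphi_x^*:T_{\varphi(x)}N\to T_xM$ denote the adjoint of $d\varphi_x$ with respect to $g$ and $h$. For a local section $Y$ of $\varphi^{-1}TN$ (in particular for a vector field $Y$ on $N$, pulled back by $\varphi$), $d\varphi^*(Y)$ is a local horizontal vector field on $M$, horizontal meaning orthogonal to $\ker d\varphi$. The map $\varphi$ is pseudo-horizontally weakly conformal (PHWC) if $[d\varphi_x\circ d\varphi_x^*,J_{\varphi(x)}]=0$ for every $x\in M$. A PHWC map $\varphi$ is pseudo-horizontally homothetic (PHH) if $$d\varphi(\nabla^M_X d\varphi^*(JY))=J\,d\varphi(\nabla^M_X d\varphi^*(Y))$$ for every horizontal vector field $X$ on $M$ and every (local) vector field $Y$ on $N$; this condition is then also valid for all local sections $Y$ of $\varphi^{-1}TN$.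 $V$-minimality: let $K$ be a submanifold of $(M,g)$. The second fundamental form $A:TK\times TK\to TK^\perp$ is defined by $\nabla^M_XY=\nabla^K_XY+A(X,Y)$ for $X,Y\in\Gamma(TK)$, where $\nabla^M,\nabla^K$ are the Levi-Civita connections. Its trace is not normalized: $\mathrm{trace}(A)=\sum_jA(e_j,e_j)$ over a local orthonormal frame $\{e_j\}$ of $TK$. The submanifold $K$ is $V$-minimal if $\mathrm{trace}(A)-V$ (with $V$ restricted to $K$) is tangent to $K$ at every point of $K$, equivalently $\mathrm{trace}(A)-V^\perp=0$, where $V^\perp$ is the component of $V|_K$ normal to $K$. *)

(* Defs.v *)
From HB Require Import structures.
From mathcomp Require Import all_boot all_order all_algebra.
From mathcomp Require Import boolp classical_sets functions reals topology.
From mathcomp Require Import normedtype derive.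

Set Implicit Arguments.
Unset Strict Implicit.
Unset Printing Implicit Defensive.

Import Order.TTheory GRing.Theory Num.Theory numFieldNormedType.Exports.
Local Open Scope classical_set_scope.
Local Open Scope ring_scope.

(** Conventions.  Tangent vectors are row vectors of components in a chart, so
    matrices act on the right; in particular ['d f x v = v *m 'J f x].  A tensor
    field on a manifold is given by its components in every chart of the
    (maximal) atlas, as functions of the coordinates, subject to the usual
    transformation law; components are only meaningful for [y] in the image of
    the chart.  The identities of local differential geometry are asserted for
    the components in all charts. *)

Section Calculus.
Variable R : realType.

Fixpoint Ck (V W : normedModType R) (k : nat) (U : set V) (f : V -> W) : Prop :=
  match k with
  | 0 => forall x, U x -> {for x, continuous f}
  | k'.+1 => (forall x, U x -> differentiable f x) /\
             forall v, Ck k' U (fun x => 'D_v f x)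
  end.

Definition smooth_on (V W : normedModType R) (U : set V) (f : V -> W) : Prop :=
  forall k, Ck k U f.

Definition ip (m : nat) (A : 'M[R]_m) (u v : 'rV[R]_m) : R :=
  (u *m A *m v^T) 0 0.

(* Trace of the (vector-valued) bilinear form [B] with respect to the inner
   product [A], in the standard basis; see [gtrace_orthonormal]. *)
Definition gtrace (m n : nat) (A : 'M[R]_m)
    (B : 'rV[R]_m -> 'rV[R]_m -> 'rV[R]_n) : 'rV[R]_n :=
  \sum_(i < m) \sum_(j < m) invmx A i j *: B (delta_mx 0 i) (delta_mx 0 j).

Lemma gtrace_orthonormal (m n : nat) (A : 'M[R]_m)
    (B : 'rV[R]_m -> 'rV[R]_m -> 'rV[R]_n) (e : 'I_m -> 'rV[R]_m) :
  (forall a u u' v, B (a *: u + u') v = a *: B u v + B u' v) ->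
  (forall a u v v', B u (a *: v + v') = a *: B u v + B u v') ->
  (forall i j, ip A (e i) (e j) = (i == j)%:R) ->
  \sum_(a < m) B (e a) (e a) = gtrace A B.
Proof.
move=> Bl Br eON.
have Bsuml (I : finType) (c : I -> R) (u : I -> 'rV_m) v :
    B (\sum_i c i *: u i) v = \sum_i c i *: B (u i) v.
  have B0 : B 0 v = 0.
    by have := Bl 1 0 0 v; rewrite !scale1r addr0 => /eqP;
       rewrite -subr_eq0 opprD addrA subrr sub0r oppr_eq0 => /eqP.
  by elim/big_rec2: _ => [//|i x y _ <-]; rewrite Bl.
have Bsumr (I : finType) (c : I -> R) u (v : I -> 'rV_m) :
    B u (\sum_i c i *: v i) = \sum_i c i *: B u (v i).
  have B0 : B u 0 = 0.
    by have := Br 1 u 0 0; rewrite !scale1r addr0 => /eqP;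
       rewrite -subr_eq0 opprD addrA subrr sub0r oppr_eq0 => /eqP.
  by elim/big_rec2: _ => [//|i x y _ <-]; rewrite Br.
pose E : 'M[R]_m := \matrix_a e a.
have EAE : E *m A *m E^T = 1%:M.
  apply/matrixP=> i j; rewrite [RHS]mxE -(eON i j) /ip !mxE.
  apply: eq_bigr => k _; rewrite !mxE; congr (_ * _).
  by apply: eq_bigr => l _; rewrite !mxE.
have AE : A *m (E^T *m E) = 1%:M.
  by rewrite mulmxA mulmx1C // mulmxA.
have -> : gtrace A B = \sum_i \sum_j (E^T *m E) i j *:
    B (delta_mx 0 i) (delta_mx 0 j).
  have [Au _] := mulmx1_unit AE.
  by rewrite /gtrace -[E^T *m E](mulKmx Au) AE mulmx1.
transitivity (\sum_a \sum_i \sum_j (e a 0 i * e a 0 j) *: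
    B (delta_mx 0 i) (delta_mx 0 j)).
  apply: eq_bigr => a _; rewrite {1 2}(row_sum_delta (e a)) Bsuml.
  by apply: eq_bigr => i _; rewrite Bsumr scaler_sumr;
     apply: eq_bigr => j _; rewrite scalerA.
rewrite exchange_big; apply: eq_bigr => i _ /=.
rewrite exchange_big; apply: eq_bigr => j _ /=.
by rewrite -scaler_suml mxE; congr (_ *: _); apply: eq_bigr => a _; rewrite !mxE.
Qed.

(** Below, [G] and [H] are the component matrices of Riemannian metrics on open
    subsets of the coordinate spaces. *)

(* The vector [\sum_k Gamma^k_ij u_i v_j d_k]: Koszul's formula for the
   constant coordinate fields [u], [v], with the index raised. *)
Definition christoffel (m : nat) (G : 'rV[R]_m -> 'M[R]_m)
    (x u v : 'rV[R]_m) : 'rV[R]_m :=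
  (\row_(l < m) (2^-1 *
     ('D_u (fun y => ip (G y) v (delta_mx 0 l) : R^o) x
      + 'D_v (fun y => ip (G y) u (delta_mx 0 l) : R^o) x
      - 'D_(delta_mx 0 l) (fun y => ip (G y) u v : R^o) x))) *m invmx (G x).

(* Levi-Civita covariant derivative at [x] of the vector field [Y] along [v]. *)
Definition cov (m : nat) (G : 'rV[R]_m -> 'M[R]_m)
    (Y : 'rV[R]_m -> 'rV[R]_m) (x v : 'rV[R]_m) : 'rV[R]_m :=
  'D_v Y x + christoffel G x v (Y x).

(* Pull-back of the Levi-Civita connection of [H] by [f], applied to a section
   [Z] of the pulled-back tangent bundle. *)
Definition cov_along (m n : nat) (H : 'rV[R]_n -> 'M[R]_n)
    (f : 'rV[R]_m -> 'rV[R]_n) (Z : 'rV[R]_m -> 'rV[R]_n)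
    (x v : 'rV[R]_m) : 'rV[R]_n :=
  'D_v Z x + christoffel H (f x) ('d f x v) (Z x).

(* [nabla (df) (X, Y)] at [x].  When [f] is the inclusion of a submanifold with
   its induced metric, this is the second fundamental form [A (X, Y)]. *)
Definition second_fund (m n : nat) (G : 'rV[R]_m -> 'M[R]_m)
    (H : 'rV[R]_n -> 'M[R]_n) (f : 'rV[R]_m -> 'rV[R]_n)
    (X Y : 'rV[R]_m -> 'rV[R]_m) (x : 'rV[R]_m) : 'rV[R]_n :=
  cov_along H f (fun z => 'd f z (Y z)) x (X x) - 'd f x (cov G Y x (X x)).

(* [second_fund] is tensorial, so vectors are extended as constant fields. *)
Definition tension (m n : nat) (G : 'rV[R]_m -> 'M[R]_m)
    (H : 'rV[R]_n -> 'M[R]_n) (f : 'rV[R]_m -> 'rV[R]_n)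
    (x : 'rV[R]_m) : 'rV[R]_n :=
  gtrace (G x) (fun u v => second_fund G H f (fun=> u) (fun=> v) x).

Definition induced_metric (m n : nat) (H : 'rV[R]_n -> 'M[R]_n)
    (f : 'rV[R]_m -> 'rV[R]_n) (x : 'rV[R]_m) : 'M[R]_m :=
  'J f x *m H (f x) *m ('J f x)^T.

(* The adjoint of ['d f x]; see [adjointP]. *)
Definition adjoint (m n : nat) (G : 'rV[R]_m -> 'M[R]_m)
    (H : 'rV[R]_n -> 'M[R]_n) (f : 'rV[R]_m -> 'rV[R]_n)
    (x : 'rV[R]_m) (w : 'rV[R]_n) : 'rV[R]_m :=
  w *m H (f x) *m ('J f x)^T *m invmx (G x).

Lemma adjointP (m n : nat) (G : 'rV[R]_m -> 'M[R]_m)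
    (H : 'rV[R]_n -> 'M[R]_n) (f : 'rV[R]_m -> 'rV[R]_n)
    (x v : 'rV[R]_m) (w : 'rV[R]_n) :
  G x \in unitmx ->
  ip (G x) (adjoint G H f x w) v = ip (H (f x)) w ('d f x v).
Proof.
move=> Gu; rewrite /ip /adjoint mulmxKV //.
have -> : 'd f x v = v *m 'J f x by rewrite mul_rV_lin1.
by rewrite trmx_mul !mulmxA.
Qed.

End Calculus.

Section Manifolds.
Variable R : realType.

Record chart (M : topologicalType) (m : nat) := Chart {
  cdom : set M;
  cmap : M -> 'rV[R]_m;
  cinv : 'rV[R]_m -> M;
  cdom_open : open cdom;
  cimg_open : open (cmap @` cdom);
  cmapK : forall x, cdom x -> cinv (cmap x) = x;
  cmap_continuous : forall x, cdom x -> {for x, continuous cmap};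
  cinv_continuous : forall y, (cmap @` cdom) y -> {for y, continuous cinv}
}.

Definition cimg (M : topologicalType) (m : nat) (c : chart M m) :
    set 'rV[R]_m :=
  cmap c @` cdom c.

Definition overlap (M : topologicalType) (m : nat) (c c' : chart M m) :
    set 'rV[R]_m :=
  cmap c @` (cdom c `&` cdom c').

Definition transition (M : topologicalType) (m : nat) (c c' : chart M m) :
    'rV[R]_m -> 'rV[R]_m :=
  cmap c' \o cinv c.

Record manifold (m : nat) := Manifold {
  mcarrier :> topologicalType;
  mhausdorff : hausdorff_space mcarrier;
  msecond_countable : @second_countable mcarrier;
  atlas : set (chart mcarrier m);
  atlas_cover : forall x, exists2 c, atlas c & cdom c x;
  atlas_compat : forall c c', atlas c -> atlas c' ->
    smooth_on (overlap c c') (transition c c');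
  atlas_max : forall c,
    (forall c', atlas c' ->
       smooth_on (overlap c c') (transition c c') /\
       smooth_on (overlap c' c) (transition c' c)) ->
    atlas c
}.

Record vfield (m : nat) (M : manifold m) := VField {
  vf_comp :> chart M m -> 'rV[R]_m -> 'rV[R]_m;
  vf_smooth : forall c, atlas c -> smooth_on (cimg c) (vf_comp c);
  vf_trans : forall c c', atlas c -> atlas c' ->
    forall y, overlap c c' y ->
    vf_comp c' (transition c c' y) = 'd (transition c c') y (vf_comp c y)
}.

Record metric (m : nat) (M : manifold m) := Metric {
  metric_comp :> chart M m -> 'rV[R]_m -> 'M[R]_m;
  metric_smooth : forall c, atlas c -> smooth_on (cimg c) (metric_comp c);
  metric_sym : forall c, atlas c -> forall y, cimg c y ->
    forall u v, ip (metric_comp c y) u v = ip (metric_comp c y) v u;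
  metric_pos : forall c, atlas c -> forall y, cimg c y ->
    forall u, u != 0 -> 0 < ip (metric_comp c y) u u;
  metric_trans : forall c c', atlas c -> atlas c' ->
    forall y, overlap c c' y -> forall u v,
    ip (metric_comp c' (transition c c' y))
       ('d (transition c c') y u) ('d (transition c c') y v)
    = ip (metric_comp c y) u v
}.

Record acstruct (m : nat) (M : manifold m) := AlmostComplex {
  acs_comp :> chart M m -> 'rV[R]_m -> 'M[R]_m;
  acs_smooth : forall c, atlas c -> smooth_on (cimg c) (acs_comp c);
  acs_sqr : forall c, atlas c -> forall y, cimg c y ->
    acs_comp c y *m acs_comp c y = - 1%:M;
  acs_trans : forall c c', atlas c -> atlas c' ->
    forall y, overlap c c' y -> forall u,
    'd (transition c c') y u *m acs_comp c' (transition c c' y)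
    = 'd (transition c c') y (u *m acs_comp c y)
}.

(* [h] is Hermitian and [J] is parallel: [nabla_v (J Y) = J (nabla_v Y)] for
   all local vector fields [Y]. *)
Definition kahler (m : nat) (M : manifold m) (J : acstruct M) (h : metric M) :
    Prop :=
  forall c, atlas c ->
    (forall y, cimg c y -> forall u v,
       ip (h c y) (u *m J c y) (v *m J c y) = ip (h c y) u v) /\
    (forall (O : set 'rV[R]_m) (Y : 'rV[R]_m -> 'rV[R]_m),
       open O -> O `<=` cimg c -> smooth_on O Y ->
       forall y, O y -> forall v,
       cov (h c) (fun z => Y z *m J c z) y v = cov (h c) Y y v *m J c y).

Section Maps.
Variables (m n : nat) (M : manifold m) (N : manifold n).
Implicit Type phi : M -> N.

Definition rep phi (c : chart M m) (d : chart N n) : 'rV[R]_m -> 'rV[R]_n :=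
  cmap d \o phi \o cinv c.

Definition rep_dom phi (c : chart M m) (d : chart N n) : set 'rV[R]_m :=
  cmap c @` (cdom c `&` phi @^-1` cdom d).

Definition smooth_map phi : Prop :=
  continuous phi /\
  forall c d, atlas c -> atlas d -> smooth_on (rep_dom phi c d) (rep phi c d).

Definition submersion phi : Prop :=
  smooth_map phi /\
  forall c d, atlas c -> atlas d -> forall y, rep_dom phi c d y ->
  forall w, exists v, 'd (rep phi c d) y v = w.

Definition V_harmonic (g : metric M) (h : metric N) (V : vfield M) phi : Prop :=
  smooth_map phi /\
  forall c d, atlas c -> atlas d -> forall y, rep_dom phi c d y ->
  tension (g c) (h d) (rep phi c d) y + 'd (rep phi c d) y (V c y) = 0.

Definition PHWC (g : metric M) (J : acstruct N) (h : metric N) phi : Prop :=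
  smooth_map phi /\
  forall c d, atlas c -> atlas d -> forall y, rep_dom phi c d y ->
  let f := rep phi c d in
  forall w,
    'd f y (adjoint (g c) (h d) f y (w *m J d (f y)))
    = 'd f y (adjoint (g c) (h d) f y w) *m J d (f y).

(* [X] is a horizontal vector field on the coordinate patch [O] of [M], and
   [Y] a vector field on the coordinate patch [W] of [N]. *)
Definition PHH (g : metric M) (J : acstruct N) (h : metric N) phi : Prop :=
  PHWC g J h phi /\
  forall c d, atlas c -> atlas d ->
  let f := rep phi c d in
  let dstar := adjoint (g c) (h d) f in
  forall (O : set 'rV[R]_m) (W : set 'rV[R]_n)
         (X : 'rV[R]_m -> 'rV[R]_m) (Y : 'rV[R]_n -> 'rV[R]_n),
  open O -> O `<=` rep_dom phi c d -> open W -> W `<=` cimg d ->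
  f @` O `<=` W ->
  smooth_on O X ->
  (forall y, O y -> forall v, 'd f y v = 0 -> ip (g c y) (X y) v = 0) ->
  smooth_on W Y ->
  forall y, O y ->
    'd f y (cov (g c) (fun z => dstar z (Y (f z) *m J d (f z))) y (X y))
    = 'd f y (cov (g c) (fun z => dstar z (Y (f z))) y (X y)) *m J d (f y).

End Maps.

Section Submanifolds.
Variables (m : nat) (M : manifold m).

(* The inclusion [u |-> (u, 0)], when [k <= m]. *)
Definition incl (k : nat) (u : 'rV[R]_k) : 'rV[R]_m := u *m pid_mx k.

Definition slice_chart (k : nat) (K : set M) (c : chart M m) : Prop :=
  [/\ atlas c, (k <= m)%N &
      forall x, cdom c x -> (K x <-> exists u : 'rV[R]_k, cmap c x = incl u)].

(* Embedded [k]-dimensional submanifolds.  In a slice chart of [K], [incl] is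
   the coordinate expression of the inclusion of [K] in [M], and the tangent
   space of [K] is the image of its differential. *)
Definition submanifold (k : nat) (K : set M) : Prop :=
  forall x, K x -> exists2 c, slice_chart k K c & cdom c x.

Definition complex_submanifold (J : acstruct M) (k : nat) (K : set M) : Prop :=
  submanifold k K /\
  forall c, slice_chart k K c ->
  forall u : 'rV[R]_k, cimg c (incl u) ->
  forall w, exists w', 'd (@incl k) u w *m J c (incl u) = 'd (@incl k) u w'.

(* [trace A - V] is tangent to [K], where [A] is the second fundamental form of
   [K], that is, of its inclusion for the induced metric. *)
Definition V_minimal (g : metric M) (V : vfield M) (k : nat) (K : set M) :
    Prop :=
  submanifold k K /\
  forall c, slice_chart k K c ->
  forall u : 'rV[R]_k, cimg c (incl u) ->
  exists w,
    tension (induced_metric (g c) (@incl k)) (g c) (@incl k) u - V c (incl u)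
    = 'd (@incl k) u w.

End Submanifolds.

End Manifolds.

(* Main.v *)
Require Import Defs.
From HB Require Import structures.
From mathcomp Require Import all_boot all_order all_algebra.
From mathcomp Require Import boolp classical_sets functions reals topology.
From mathcomp Require Import normedtype derive landau sequences.
From mathcomp Require Import interval_inference ring lra.

Set Implicit Arguments.
Unset Strict Implicit.
Unset Printing Implicit Defensive.

Import Order.TTheory GRing.Theory Num.Theory numFieldNormedType.Exports.
Local Open Scope classical_set_scope.
Local Open Scope ring_scope.

(** Let [K] be the preimage of [P], [S] the inverse of the metric induced on
    [TK], extended by [0] to a 2-tensor on [TM], and [B = nabla df].  Modulo
    [TK], the trace of the second fundamental form of [K] is the contraction of
    [S] with the Christoffel symbols of [g], so that its image under [df] is,
    modulo [TP], the contraction of [f_* S] with the second fundamental form of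
    [P], minus that of [S] with [B]; by [V]-harmonicity the latter equals
    [- df V] minus the contraction of [g^-1 - S], the cometric of the normal
    space, with [B].  As [TK] is the preimage of [TP] under [df], it suffices to
    see that two contractions vanish.  PHWC means that the cometric pushed forward by [df] is
    [J]-invariant, hence so are [f_* S], the inverse of the restriction to [TP]
    of the corresponding metric, and the tensor on [TN] that corresponds to
    [g^-1 - S] under the adjoint [df^*].  On the other hand the second
    fundamental form of the complex submanifold [P] of a Kaehler manifold, and,
    by PHH, the form [(w, w') |-> B (df^* w, df^* w')], are symmetric and
    complex linear in each argument, so both change sign under [(J, J)].

    That [K] is a submanifold follows from the inverse function theorem. *)

(** * Differentials *)

Section Differentials.
Variable R : realType.
Implicit Types U V W X : normedModType R.

(** The estimate is the little-o condition written out. It also identifies the differential, so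
    later proofs can exhibit [L] by plain inequalities. *)
Lemma is_diff_eps V W (f : V -> W) (x : V) (L : {linear V -> W}) :
  continuous L ->
  (forall e, 0 < e -> \forall h \near (0 : V),
     `|f (h + x) - f x - L h| <= e * `|h|) ->
  is_diff x f L.
Proof.
move=> Lc fL.
have fo : f \o shift x = cst (f x) + (L : V -> W) +o_ 0 id.
  apply/eqaddoP => e e0; near=> h.
  rewrite [X in `|X|](_ : _ = f (h + x) - f x - L h); last first.
    by rewrite -addrA -opprD.
  by near: h; exact: fL.
have dfL := diff_unique Lc fo.
apply: DiffDef => //; apply/diff_locallyP; rewrite dfL; split => //.
Unshelve. all: by end_near. Qed.

Lemma differentiable_eps V W (f : V -> W) (x : V) :
  differentiable f x -> forall e, 0 < e ->
  \forall h \near (0 : V), `|f (h + x) - f x - 'd f x h| <= e * `|h|.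
Proof.
move=> /diff_locallyP[_ /eqaddoP fo] e /fo; apply: filterS => h.
by rewrite [X in `|X| <= _ -> _](_ : _ = f (h + x) - f x - 'd f x h)// -addrA
  -opprD.
Qed.

Lemma near_is_diff V W (f g : V -> W) (x : V) :
  (\forall y \near x, f y = g y) -> differentiable f x ->
  is_diff x g ('d f x).
Proof.
move=> fg df; apply: is_diff_eps; first exact: diff_continuous.
move=> e e0; near=> h.
have <- : f (h + x) = g (h + x).
  by near: h; move: fg; rewrite (near_shift 0)/= subr0.
rewrite -(nbhs_singleton fg); near: h; exact: differentiable_eps.
Unshelve. all: by end_near. Qed.

Lemma open_eq_differentiable V W (A : set V) (f g : V -> W) (x : V) :
  open A -> A x -> {in A, f =1 g} -> differentiable f x -> differentiable g x.
Proof.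
move=> oA Ax fg /(@near_is_diff _ _ _ g x)[]//.
near=> y; apply: fg; rewrite inE; near: y; exact: open_nbhs_nbhs.
Unshelve. all: by end_near. Qed.

Lemma open_eq_derive V W (A : set V) (f g : V -> W) (x v : V) :
  open A -> A x -> {in A, f =1 g} -> 'D_v f x = 'D_v g x.
Proof.
move=> oA Ax fg; apply: near_eq_derive.
near=> y; apply: fg; rewrite inE; near: y; exact: open_nbhs_nbhs.
Unshelve. all: by end_near. Qed.

Lemma derive_comp V W X (f : V -> W) (g : W -> X) (x v : V) :
  differentiable f x -> differentiable g (f x) ->
  'D_v (g \o f) x = 'd g (f x) ('D_v f x).
Proof.
move=> df dg; rewrite deriveE; last exact: differentiable_comp.
by rewrite diff_comp//= deriveE.
Qed.

Lemma derive_lin V W X (f : V -> W) (L : {linear W -> X}) (x v : V) :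
  continuous L -> differentiable f x ->
  'D_v (L \o f) x = L ('D_v f x).
Proof.
move=> Lc df; rewrite derive_comp//; first by rewrite diff_lin.
exact: linear_differentiable.
Qed.

Section Bilinear.
Variables (V W X Y : normedModType R) (B : {bilinear W -> X -> Y}).
Hypothesis Bc : continuous (fun p => B p.1 p.2).

Lemma differentiable_bilin2 (f : V -> W) (g : V -> X) (x : V) :
  differentiable f x -> differentiable g x ->
  differentiable (fun y => B (f y) (g y)) x.
Proof.
move=> df dg.
apply: (@differentiable_comp _ _ _ _ (fun y => (f y, g y)) (fun p => B p.1
  p.2)).
  exact: differentiable_pair.
exact: differentiable_bilin.
Qed.

Lemma derive_bilin (f : V -> W) (g : V -> X) (x v : V) :
  differentiable f x -> differentiable g x ->
  'D_v (fun y => B (f y) (g y)) x = B ('D_v f x) (g x) + B (f x) ('D_v g x).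
Proof.
move=> df dg; rewrite deriveE; last exact: differentiable_bilin2.
rewrite (@diff_comp _ _ _ _ (fun y => (f y, g y)) (fun p => B p.1 p.2))//=.
- by rewrite diff_bilin//= diff_pair//= !deriveE// addrC.
- exact: differentiable_pair.
- exact: differentiable_bilin.
Qed.
End Bilinear.

End Differentials.

(** * Continuity of linear and bilinear maps on matrix spaces *)

Section MatrixContinuity.
Variable R : realType.

Lemma continuous_sum_fun (T : topologicalType) (W : normedModType R) (I : Type)
    (r : seq I) (F : I -> T -> W) :
  (forall i, continuous (F i)) -> continuous (fun x => \sum_(i <- r) F i x).
Proof.
move=> Fc x; elim: r => [|i r IH].
  under eq_fun do rewrite big_nil; exact: cst_continuous.
under eq_fun do rewrite big_cons.
by apply: continuousD => //; exact: Fc.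
Qed.

Lemma mx_linear_continuous m n (W : normedModType R)
    (L : {linear 'M[R]_(m, n) -> W}) : continuous L.
Proof.
rewrite (_ : (L : _ -> _) =
    (fun A => \sum_i \sum_j A i j *: L (delta_mx i j))); last first.
  apply/funext => A; rewrite {1}[A]matrix_sum_delta linear_sum.
  by apply: eq_bigr => i _; rewrite linear_sum; apply: eq_bigr => j _;
    rewrite linearZ.
apply: continuous_sum_fun => i; apply: continuous_sum_fun => j A.
apply: (@continuousZr_tmp _ _ _ (fun A : 'M[R]_(m, n) => A i j) (L (delta_mx i
  j))).
exact: coord_continuous.
Qed.

Lemma mx_bilinear_continuous m n p q (W : normedModType R)
    (B : {bilinear 'M[R]_(m, n) -> 'M[R]_(p, q) -> W}) :
  continuous (fun x => B x.1 x.2).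
Proof.
rewrite (_ : (fun x => _) = (fun x : 'M[R]_(m, n) * 'M[R]_(p, q) =>
    \sum_i \sum_j x.1 i j *: B (delta_mx i j) x.2)); last first.
  apply/funext => x; rewrite {1}[x.1]matrix_sum_delta linear_sumlz.
  apply: eq_bigr => i _; rewrite linear_sumlz; apply: eq_bigr => j _.
  by rewrite linearZl_LR.
apply: continuous_sum_fun => i; apply: continuous_sum_fun => j x.
have := @continuousZ R W _ (fun x : 'M[R]_(m, n) * 'M[R]_(p, q) => x.1 i j)
  (fun x => B (delta_mx i j) x.2) x.
apply.
  apply: (@continuous_comp _ _ _ fst (fun A : 'M[R]_(m, n) => A i j)).
    exact: cvg_fst.
  exact: coord_continuous.
apply: (@continuous_comp _ _ _ snd (B (delta_mx i j))).
  exact: cvg_snd.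
exact: mx_linear_continuous.
Qed.
End MatrixContinuity.

(** * Functions of class C^k *)

Section CkTheory.
Variable R : realType.
Implicit Types V W X Y : normedModType R.

Lemma CkSP V W k (A : set V) (f : V -> W) :
  Ck k.+1 A f <->
  (forall x, A x -> differentiable f x) /\ forall v, Ck k A ('D_v f).
Proof. by []. Qed.

Lemma CkW V W k (A : set V) (f : V -> W) : Ck k.+1 A f -> Ck k A f.
Proof.
elim: k f => [f [df _] x Ax|k IH f /CkSP[df Df]].
  by apply: differentiable_continuous; exact: df.
by apply/CkSP; split => // v; exact: IH (Df v).
Qed.

Lemma Ck_differentiable V W k (A : set V) (f : V -> W) x :
  Ck k.+1 A f -> A x -> differentiable f x.
Proof. by move=> [df _]; exact: df. Qed.

Lemma Ck_sub V W k (A A' : set V) (f : V -> W) :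
  A' `<=` A -> Ck k A f -> Ck k A' f.
Proof.
move=> sA; elim: k f => [f fc x /sA|k IH f /CkSP[df Df]]; first exact: fc.
by apply/CkSP; split=> [x /sA|v]; [exact: df|exact: IH (Df v)].
Qed.

(** Openness of [A] makes the derivatives of [f] and [g] agree on [A], so the induction goes
    through. The inductions below use this to replace a derivative by its explicit formula. *)
Lemma Ck_ext V W k (A : set V) (f g : V -> W) :
  open A -> {in A, f =1 g} -> Ck k A f -> Ck k A g.
Proof.
move=> oA; elim: k f g => [f g fg fc x Ax|k IH f g fg /CkSP[df Df]].
  rewrite /prop_for /continuous_at -fg ?inE//.
  apply: cvg_trans (fc x Ax); apply: near_eq_cvg; near=> y.
  by apply: fg; rewrite inE; near: y; exact: open_nbhs_nbhs.
apply/CkSP; split=> [x Ax|v];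
  first exact: (open_eq_differentiable oA Ax fg (df x Ax)).
apply: (IH ('D_v f)) => // x; rewrite inE => Ax.
exact: (open_eq_derive _ oA Ax fg).
Unshelve. all: by end_near. Qed.

Lemma Ck_cst V W k (A : set V) (w : W) : Ck k A (cst w).
Proof.
elim: k w => [w x _|k IH w]; first exact: cst_continuous.
apply/CkSP; split => // v; rewrite (_ : 'D_v _ = cst 0)//.
by apply/funext => x; exact: derive_cst.
Qed.

Lemma Ck_lin V W X k (A : set V) (f : V -> W) (L : {linear W -> X}) :
  open A -> continuous L -> Ck k A f -> Ck k A (L \o f).
Proof.
move=> oA Lc; elim: k f => [f fc x Ax|k IH f /CkSP[df Df]].
  by apply: continuous_comp; [exact: fc|exact: Lc].
apply/CkSP; split=> [x Ax|v].
  by apply: differentiable_comp; [exact: df|exact: linear_differentiable].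
apply: (Ck_ext oA _ (IH _ (Df v))) => x; rewrite inE => Ax.
by rewrite derive_lin//; exact: df.
Qed.

Lemma CkD V W k (A : set V) (f g : V -> W) :
  open A -> Ck k A f -> Ck k A g -> Ck k A (f \+ g).
Proof.
move=> oA; elim: k f g => [f g fc gc x Ax|k IH f g /CkSP[df Df] /CkSP[dg Dg]].
  by apply: continuousD; [exact: fc|exact: gc].
apply/CkSP; split=> [x Ax|v].
  by apply: differentiableD; [exact: df|exact: dg].
apply: (Ck_ext oA _ (IH _ _ (Df v) (Dg v))) => x; rewrite inE => Ax.
by rewrite /= -deriveD//; apply: diff_derivable; [exact: df|exact: dg].
Qed.

Lemma Ck_sum V W k (A : set V) (I : Type) (r : seq I) (F : I -> V -> W) :
  open A -> (forall i, Ck k A (F i)) -> Ck k A (fun x => \sum_(i <- r) F i x).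
Proof.
move=> oA FC; elim: r => [|i r IH].
  by under eq_fun do rewrite big_nil; exact: Ck_cst.
by under eq_fun do rewrite big_cons; exact: CkD.
Qed.

(** The Leibniz rule gives two terms of the same bilinear shape, to which the induction hypothesis
    applies. Scalings, products and matrix products are instances. *)
Lemma Ck_bilin V W X Y k (A : set V) (f : V -> W) (g : V -> X)
    (B : {bilinear W -> X -> Y}) :
  open A -> continuous (fun p => B p.1 p.2) ->
  Ck k A f -> Ck k A g -> Ck k A (fun x => B (f x) (g x)).
Proof.
move=> oA Bc; elim: k f g => [f g fc gc x Ax|k IH f g fC gC].
  apply: (@continuous_comp _ _ _ (fun y => (f y, g y)) (fun p => B p.1 p.2)).
    by apply: cvg_pair => /=; [exact: fc|exact: gc].
  exact: Bc.
have /CkSP[df Df] := fC; have /CkSP[dg Dg] := gC.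
apply/CkSP; split=> [x Ax|v].
  by apply: differentiable_bilin2; [|exact: df|exact: dg].
have DC := CkD oA (IH _ _ (Df v) (CkW gC)) (IH _ _ (CkW fC) (Dg v)).
apply: (Ck_ext oA _ DC) => x; rewrite inE => Ax /=.
by rewrite derive_bilin//; [exact: df|exact: dg].
Qed.

Lemma derive_comp_rV V n W (f : V -> 'rV[R]_n) (g : 'rV[R]_n -> W) x v :
  differentiable f x -> differentiable g (f x) ->
  'D_v (g \o f) x = \sum_i ('D_v f x) 0 i *: 'D_(delta_mx 0 i) g (f x).
Proof.
move=> df dg; rewrite derive_comp//.
rewrite [X in 'd g _ X]row_sum_delta linear_sum.
by apply: eq_bigr => i _; rewrite linearZ/= -deriveE.
Qed.

End CkTheory.

(** * Matrix-valued functions through their entries *)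

Section CkMatrix.
Variables (R : realType) (V : normedModType R).

Definition mxcoord m n i j (A : 'M[R]_(m, n)) : R^o := A i j.

Lemma mxcoord_is_linear m n i j : linear (@mxcoord m n i j).
Proof. by move=> a u v; rewrite /mxcoord !mxE. Qed.

HB.instance Definition _ m n i j :=
  GRing.isLinear.Build R 'M[R]_(m, n) R^o _ (@mxcoord m n i j)
    (mxcoord_is_linear i j).

Lemma Ck_coord m n k (A : set V) (f : V -> 'M[R]_(m, n)) i j :
  open A -> Ck k A f -> Ck k A (fun x => f x i j : R^o).
Proof.
move=> oA fC.
apply: (@Ck_lin _ _ _ _ k A f (mxcoord i j)) => //.
exact: mx_linear_continuous.
Qed.

Lemma CkZr (W : normedModType R) k (A : set V) (s : V -> R^o) (w : W) :
  open A -> Ck k A s -> Ck k A (fun x => s x *: w).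
Proof.
move=> oA sC.
have slin : linear ( *:%R ^~ w : R^o -> W).
  by move=> u y z; rewrite scalerDl scalerA.
pose L : {linear R^o -> W} := HB.pack ( *:%R ^~ w : R^o -> W)
  (GRing.isLinear.Build _ _ _ _ _ slin).
apply: (@Ck_lin _ _ _ _ k A s L) => //.
exact: scalel_continuous.
Qed.

Lemma Ck_mx m n k (A : set V) (f : V -> 'M[R]_(m, n)) :
  open A -> (forall i j, Ck k A (fun x => f x i j : R^o)) -> Ck k A f.
Proof.
move=> oA fC; rewrite (_ : f = fun x => \sum_i \sum_j f x i j *: delta_mx i j).
  by apply: Ck_sum => // i; apply: Ck_sum => // j; exact: CkZr.
by apply/funext => x; exact: matrix_sum_delta.
Qed.

Lemma CkM k (A : set V) (f g : V -> R^o) :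
  open A -> Ck k A f -> Ck k A g -> Ck k A (fun x => f x * g x : R^o).
Proof.
move=> oA fC gC; apply: (Ck_bilin oA _ fC gC).
by move=> x; apply: (@continuousM _ _ fst snd); [exact: cvg_fst|exact: cvg_snd].
Qed.

End CkMatrix.

(** * Products, inverses, compositions and Jacobians *)

Section SmoothTheory.
Variable R : realType.

Definition scale_bil (W : normedModType R) (s : R^o) (w : W) : W := s *: w.

Lemma scale_is_bilinear (W : normedModType R) :
  bilinear_for (GRing.Scale.Law.clone _ _ *:%R _)
    (GRing.Scale.Law.clone _ _ *:%R _) (@scale_bil W).
Proof.
split=> [u'|u] a x y; rewrite /scale_bil /=.
- by rewrite scalerDl scalerA.
- by rewrite scalerDr !scalerA mulrC.
Qed.

HB.instance Definition _ (W : normedModType R) :=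
  bilinear_isBilinear.Build R R^o W W _ _ (@scale_bil W) (@scale_is_bilinear W).

Section Ck.
Variables (V : normedModType R) (k : nat) (A : set V).
Hypothesis oA : open A.

Lemma CkZ (W : normedModType R) (s : V -> R^o) (w : V -> W) :
  Ck k A s -> Ck k A w -> Ck k A (fun x => s x *: w x).
Proof.
move=> sC wC.
apply: (@Ck_bilin R V R^o W W k A s w (@scale_bil W) oA _ sC wC).
by move=> x; apply: (@continuousZ _ _ _ fst snd);
  [exact: cvg_fst|exact: cvg_snd].
Qed.

Lemma Ck_prod (I : Type) (r : seq I) (F : I -> V -> R^o) :
  (forall i, Ck k A (F i)) -> Ck k A (fun x => \prod_(i <- r) F i x : R^o).
Proof.
move=> FC; elim: r => [|i r IH].
  by under eq_fun do rewrite big_nil; exact: Ck_cst.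
by under eq_fun do rewrite big_cons; exact: CkM.
Qed.

Lemma Ck_det n (f : V -> 'M[R]_n) :
  Ck k A f -> Ck k A (fun x => \det (f x) : R^o).
Proof.
move=> fC; apply: Ck_sum => // s; apply: CkM => //; first exact: Ck_cst.
by apply: Ck_prod => i; exact: Ck_coord.
Qed.

Lemma Ck_mulmx m n p (f : V -> 'M[R]_(m, n)) (g : V -> 'M[R]_(n, p)) :
  Ck k A f -> Ck k A g -> Ck k A (fun x => f x *m g x).
Proof.
move=> fC gC; apply: (Ck_bilin (B := @mulmx R m n p) oA _ fC gC).
exact: mx_bilinear_continuous.
Qed.

Lemma Ck_trmx m n (f : V -> 'M[R]_(m, n)) :
  Ck k A f -> Ck k A (fun x => (f x)^T).
Proof.
move=> fC; apply: (Ck_lin (L := @trmx R m n) oA _ fC).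
exact: mx_linear_continuous.
Qed.

End Ck.

(** The derivative of the inverse is a polynomial in the inverse and the derivative of [f], so one
    order of regularity is gained at each step. *)
Lemma CkV (V : normedModType R) k (A : set V) (f : V -> R^o) :
  open A -> (forall x, A x -> f x != 0) -> Ck k A f ->
  Ck k A (fun x => (f x)^-1 : R^o).
Proof.
move=> oA f0; elim: k f f0 => [f f0 fc x Ax|k IH f f0 fC].
  by apply: continuousV; [exact: f0|exact: fc].
have /CkSP[df Df] := fC.
apply/CkSP; split=> [x Ax|v].
  by apply: differentiableV; [exact: df|exact: f0].
have fV := IH f f0 (CkW fC).
have fN : Ck k A (fun x => -1 * ((f x)^-1 * (f x)^-1 * 'D_v f x) : R^o).
  apply: CkM => //; first exact: Ck_cst.
  by apply: CkM => //; exact: CkM.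
apply: (Ck_ext oA _ fN) => x; rewrite inE => Ax.
rewrite mulN1r -invfM -expr2; apply/esym.
have fv : derivable f x v by apply/diff_derivable/df.
by have := @deriveV _ _ f x v (f0 x Ax) fv; rewrite scaleNr.
Qed.

Lemma Ck_invmx (V : normedModType R) k (A : set V) n (f : V -> 'M[R]_n) :
  open A -> (forall x, A x -> f x \in unitmx) -> Ck k A f ->
  Ck k A (fun x => invmx (f x)).
Proof.
move=> oA fU fC.
have fdet : Ck k A (fun x => (\det (f x))^-1 *: \adj (f x)).
  apply: CkZ => //.
    apply: CkV => //; last exact: Ck_det.
    by move=> x /fU; rewrite unitmxE unitfE.
  apply: Ck_mx => // i j; under eq_fun do rewrite mxE.
  apply: CkM => //; first exact: Ck_cst.
  apply: Ck_det => //; apply: Ck_mx => // a b; under eq_fun do rewrite !mxE.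
  exact: Ck_coord.
apply: (Ck_ext oA _ fdet) => x; rewrite inE => Ax.
by rewrite /invmx fU.
Qed.

Lemma Ck_comp (V W : normedModType R) n k (A : set V) (B : set 'rV[R]_n)
    (f : V -> 'rV[R]_n) (g : 'rV[R]_n -> W) :
  open A -> (forall x, A x -> B (f x)) -> Ck k A f -> Ck k B g ->
  Ck k A (g \o f).
Proof.
move=> oA fAB; elim: k g => [|k IH] g fC gC.
  by move=> x Ax; apply: continuous_comp; [exact: fC|exact/gC/fAB].
have /CkSP[df Df] := fC; have /CkSP[dg Dg] := gC.
apply/CkSP; split=> [x Ax|v].
  by apply: differentiable_comp; [exact: df|exact/dg/fAB].
have DC : Ck k A (fun x => \sum_i ('D_v f x) 0 i *: ('D_(delta_mx 0 i) g \o f)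
  x).
  apply: Ck_sum => // i; apply: CkZ => //; first exact: Ck_coord.
  by apply: IH; [exact: CkW|exact: Dg].
apply: (Ck_ext oA _ DC) => x; rewrite inE => Ax.
by rewrite derive_comp_rV//; [exact: df|exact/dg/fAB].
Qed.

Lemma smooth_derive (V W : normedModType R) (A : set V) (f : V -> W) v :
  smooth_on A f -> smooth_on A ('D_v f).
Proof. by move=> fC k; have /CkSP[_] := fC k.+1; apply. Qed.

Lemma smooth_diff (V W : normedModType R) (A : set V) (f : V -> W) x :
  smooth_on A f -> A x -> differentiable f x.
Proof. by move=> /(_ 1%N)/CkSP[df _]; exact: df. Qed.

Lemma smooth_jacobian m n (A : set 'rV[R]_m) (f : 'rV[R]_m -> 'rV[R]_n) :
  open A -> smooth_on A f -> smooth_on A (fun x => 'J f x).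
Proof.
move=> oA fC k; apply: Ck_mx => // i j.
have DC : Ck k A (fun x => ('D_(delta_mx 0 i) f x) 0 j : R^o).
  by apply: Ck_coord => //; exact: smooth_derive.
apply: (Ck_ext oA _ DC) => x; rewrite inE => Ax.
rewrite deriveE; last exact: smooth_diff Ax.
by rewrite /jacobian /lin1_mx mxE.
Qed.

End SmoothTheory.

(** * Mean value theorem and symmetry of second derivatives *)

Section MeanValue.
Variable R : realType.

Lemma is_derive_segment (V W : normedModType R) (f : V -> W) x h (t : R) :
  differentiable f (t *: h + x) ->
  is_derive t (1 : R) (fun s : R => f (s *: h + x)) ('D_h f (t *: h + x)).
Proof.
move=> df; have dl : is_diff t (fun s : R => s *: h + x) ( *:%R ^~ h).
  have := is_diffD (is_diff_scalel t h) (is_diff_cst x t).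
  by rewrite addr0.
have dfl : differentiable (fun s : R => f (s *: h + x)) t.
  exact: (@differentiable_comp _ _ _ _ (fun s : R => s *: h + x) f).
apply: DeriveDef; first exact/diff_derivable.
rewrite deriveE// (@diff_comp _ _ _ _ (fun s : R => s *: h + x) f)//=.
by rewrite diff_val scale1r deriveE.
Qed.

Lemma mean_value (V : normedModType R) (f : V -> R^o) x h :
  (forall t : R, 0 <= t <= 1 -> differentiable f (t *: h + x)) ->
  exists2 c : R, 0 <= c <= 1 & f (h + x) - f x = 'D_h f (c *: h + x).
Proof.
move=> df.
have dg (t : R) : 0 <= t <= 1 ->
    is_derive t (1 : R) (fun s : R => f (s *: h + x) : R) ('D_h f (t *: h + x)).
  by move=> /df; exact: is_derive_segment.
have [||c] :=
    @MVT R (fun s => f (s *: h + x)) (fun s => 'D_h f (s *: h + x)) 0 1 ltr01.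
- by move=> t; rewrite in_itv/= => /andP[t0 t1]; apply: dg; rewrite !ltW.
- apply: derivable_within_continuous => s; rewrite in_itv/= => s01.
  by have [] := dg s s01.
- rewrite in_itv/= => c01; rewrite scale1r scale0r add0r subr0 mulr1 => fE;
    exists c => //.
  by case/andP: c01 => c0 c1; rewrite !ltW.
Qed.

Lemma deriveZv (V W : normedModType R) (f : V -> W) x (a : R) v :
  differentiable f x -> 'D_(a *: v) f x = a *: 'D_v f x.
Proof. by move=> df; rewrite !deriveE// linearZ. Qed.

Lemma deriveDv (V W : normedModType R) (f : V -> W) x u v :
  differentiable f x -> 'D_(u + v) f x = 'D_u f x + 'D_v f x.
Proof. by move=> df; rewrite !deriveE// linearD. Qed.

Lemma ball_segment (V : normedModType R) (x y z : V) (r c : R) :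
  ball x r y -> ball x r z -> 0 <= c <= 1 -> ball x r (c *: (z - y) + y).
Proof.
rewrite -!ball_normE/= => xy xz /andP[c0 c1].
have -> : x - (c *: (z - y) + y) = c *: (x - z) + (1 - c) *: (x - y).
  rewrite [in RHS]scalerBl scale1r addrCA -scalerBr opprB.
  by rewrite [x - z + _]addrC subrKA opprD -scalerN opprB addrCA addrC.
have le1 : `|c *: (x - z)| <= c * `|x - z| by rewrite normrZ ger0_norm.
have le2 : `|(1 - c) *: (x - y)| <= (1 - c) * `|x - y|.
  by rewrite normrZ ger0_norm// subr_ge0.
apply: le_lt_trans (ler_normD _ _) _; apply: le_lt_trans (lerD le1 le2) _.
have le3 : (1 - c) * `|x - y| <= (1 - c) * r.
  by apply: ler_wpM2l; [rewrite subr_ge0|exact: ltW].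
have [->|cn0] := eqVneq c 0; first by rewrite mul0r add0r subr0 mul1r.
have : c * `|x - z| < c * r by rewrite ltr_pM2l// lt_def cn0.
lra.
Qed.

Lemma ltr_dist_halves (W : normedModType R) (a b c : W) (d : R) :
  `|a - c| < d / 2 -> `|b - c| < d / 2 -> `|a - b| < d.
Proof.
move=> ac bc; rewrite (splitr d); apply: le_lt_trans (ltrD ac bc).
by rewrite [`|b - c|]distrC ler_distD.
Qed.

(* Both mixed derivatives are limits of the symmetric second difference
   [f (x + su + sv) - f (x + su) - f (x + sv) + f x] divided by [s ^+ 2]. *)
Lemma second_difference (V : normedModType R) (f : V -> R^o) (x u v : V) (r s :
  R) :
  Ck 2 (ball x r) f -> 0 < s -> s * (`|u| + `|v|) < r ->
  exists2 y, `|y - x| <= s * (`|u| + `|v|) &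
    f (s *: u + (s *: v + x)) - f (s *: u + x) - f (s *: v + x) + f x =
    s ^+ 2 * 'D_v ('D_u f) y.
Proof.
move=> fC s0 sr.
have bP (a b : R) : 0 <= a <= 1 -> 0 <= b <= 1 ->
    `|a *: (s *: u) + (b *: (s *: v) + x) - x| <= s * (`|u| + `|v|).
  move=> /andP[a0 a1] /andP[b0 b1]; rewrite addrA addrK !scalerA mulrDr.
  apply: le_trans (ler_normD _ _) _. rewrite !normrZ.
  rewrite (ger0_norm a0) (ger0_norm b0) (gtr0_norm s0).
  have := ler_wpM2r (normr_ge0 u) (ler_wpM2r (ltW s0) a1).
  have := ler_wpM2r (normr_ge0 v) (ler_wpM2r (ltW s0) b1).
  lra.
have bB (a b : R) : 0 <= a <= 1 -> 0 <= b <= 1 ->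
    ball x r (a *: (s *: u) + (b *: (s *: v) + x)).
  move=> a1 b1; rewrite -ball_normE/= distrC.
  by apply: le_lt_trans sr; exact: bP.
have i0 : (0 : R) <= (0 : R) <= 1 by lra.
have i1 : (0 : R) <= (1 : R) <= 1 by lra.
(* The second difference is the increment of [g] along [s *: u]. The mean value theorem is applied
   to [g] in that direction, then to ['D_u f] along [s *: v]. *)
pose g y := f (s *: v + y) - f y : R^o.
have dshift y : differentiable f (s *: v + y) ->
    is_diff y (fun y => f (s *: v + y)) ('d f (s *: v + y)).
  move=> df; have dl : is_diff y (fun y => s *: v + y) id.
    have := is_diffD (is_diff_cst (s *: v) y) (is_diff_id y).
    by rewrite add0r.
  have := @is_diff_comp _ _ _ _ _ _ _ _ y dl (differentiableP df).
  by [].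
have df (a b : R) : 0 <= a <= 1 -> 0 <= b <= 1 ->
    differentiable f (a *: (s *: u) + (b *: (s *: v) + x)).
  by move=> a1 b1; apply: Ck_differentiable fC _; exact: bB.
have dg (t : R) : 0 <= t <= 1 -> is_diff (t *: (s *: u) + x) g
    (('d f (t *: (s *: u) + (s *: v + x)) : V -> R^o)
     - ('d f (t *: (s *: u) + x) : V -> R^o)).
  move=> t1; rewrite [t *: _ + (_ + _)]addrCA.
  apply: is_diffB; last first.
    by apply/differentiableP; have := df _ _ t1 i0; rewrite scale0r add0r.
  by apply: dshift; rewrite addrCA; have := df _ _ t1 i1; rewrite scale1r.
have [t t1 gE] := mean_value (fun t t1 => @ex_diff _ _ _ _ _ _ _ (dg t t1)).
have dDf (t' : R) : 0 <= t' <= 1 ->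
    differentiable ('D_u f) (t' *: (s *: v) + (t *: (s *: u) + x)).
  have /CkSP[_ /(_ u)Du] := fC.
  by move=> t'1; apply: Ck_differentiable Du _; rewrite addrCA; exact: bB.
have [t' t'1 DE] := mean_value dDf.
exists (t' *: (s *: v) + (t *: (s *: u) + x)).
  by rewrite addrCA; exact: bP.
have dfE := df _ _ t1 i1; have dfE0 := df _ _ t1 i0.
rewrite scale1r in dfE; rewrite scale0r add0r in dfE0.
have DsE : 'D_(s *: v) ('D_u f) (t' *: (s *: v) + (t *: (s *: u) + x)) =
    s * 'D_v ('D_u f) (t' *: (s *: v) + (t *: (s *: u) + x)).
  exact: deriveZv (dDf _ t'1).
rewrite expr2 -mulrA -DsE -DE [s *: v + (t *: _ + _)]addrCA.
transitivity (g (s *: u + x) - g x).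
  by rewrite /g [s *: v + (s *: u + x)]addrCA opprB [RHS]addrA [RHS]addrAC.
have [dgt dgE] := dg _ t1; rewrite gE deriveE// dgE !deriveE// mulrBr.
by rewrite -[LHS]/('d f _ (s *: u) - 'd f _ (s *: u)) !linearZ.
Qed.

Lemma derive_sym (V : normedModType R) (A : set V) (f : V -> R^o) (x u v : V) :
  open A -> A x -> Ck 2 A f -> 'D_v ('D_u f) x = 'D_u ('D_v f) x.
Proof.
move=> oA Ax fC; apply/eqP; rewrite -subr_eq0 -normr_le0 leNgt.
apply/negP => d0; set d := `|_| in d0.
have near_eps (w z : V) : \forall y \near x,
    `|'D_w ('D_z f) x - 'D_w ('D_z f) y| < d / 2.
  have /CkSP[_ /(_ z)/CkSP[_ /(_ w)/(_ x Ax)]] := fC.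
  by move/cvgrPdist_lt; apply; rewrite divr_gt0.
have nP : \forall y \near x, [/\ A y, `|'D_v ('D_u f) x - 'D_v ('D_u f) y| < d
  / 2
    & `|'D_u ('D_v f) x - 'D_u ('D_v f) y| < d / 2].
  have nA := open_nbhs_nbhs (conj oA Ax).
  apply: (filterS _ (filterI nA (filterI (near_eps v u) (near_eps u v)))).
  by move=> y [? []].
have [r /= r0 rP] := (nbhs_normP _ _).1 nP.
(* The whole parallelogram spanned by [s *: u] and [s *: v] then lies in the ball; the summand 1
   keeps the denominator positive when both vectors vanish. *)
pose s := r / 2 / (`|u| + `|v| + 1).
have n0 : 0 < `|u| + `|v| + 1 by rewrite ltr_wpDl// addr_ge0.
have s0 : 0 < s by rewrite !divr_gt0.
have sr : s * (`|u| + `|v|) < r.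
  have : s * (`|u| + `|v| + 1) = r / 2 by rewrite divfK// gt_eqF.
  lra.
have fCr : Ck 2 (ball x r) f.
  apply: Ck_sub fC => y; rewrite -ball_normE => /rP[].
  by [].
have [y yx yE] := second_difference fCr s0 sr.
have := sr; rewrite [`|u| + _]addrC => sr'.
have [z zx zE] := second_difference fCr s0 sr'.
(* The second difference is symmetric in [u] and [v], so the two mixed derivatives coincide, though
   at different points [y] and [z]. Both points are close enough to [x] to contradict the gap
   [d]. *)
have : 'D_v ('D_u f) y = 'D_u ('D_v f) z.
  apply: (@mulfI _ (s ^+ 2)); first by rewrite expf_neq0// gt_eqF.
  apply: etrans (esym yE) _; apply: etrans zE.
  by rewrite [s *: u + (s *: v + x)]addrCA; congr (_ + _); exact: addrAC.
have [_ + _] : [/\ A y, `|'D_v ('D_u f) x - 'D_v ('D_u f) y| < d / 2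
    & `|'D_u ('D_v f) x - 'D_u ('D_v f) y| < d / 2].
  by apply: rP; rewrite /= distrC; exact: le_lt_trans sr.
have [_ _ +] : [/\ A z, `|'D_v ('D_u f) x - 'D_v ('D_u f) z| < d / 2
    & `|'D_u ('D_v f) x - 'D_u ('D_v f) z| < d / 2].
  by apply: rP; rewrite /= distrC; exact: le_lt_trans sr'.
move=> lz ly E; rewrite E in ly.
by have := ltr_dist_halves ly lz; rewrite ltxx.
Qed.

End MeanValue.

(** * The inverse function theorem *)

(* The library has no complete normed module structure on matrices, only its
   two components. *)
HB.instance Definition _ (R : realType) m n :=
  Uniform_isComplete.Build 'M[R]_(m, n) (@cauchy_cvg 'M[R]_(m, n)).

Section InverseFunction.
Variable R : realType.

Lemma mx_coord_le m n (A : 'M[R]_(m, n)) i j : `|A i j| <= `|A|.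
Proof.
by rewrite [leRHS]/Num.Def.normr/= mx_normrE; exact: (le_bigmax _ _ (i, j)).
Qed.

Lemma mx_norm_le m n (A : 'M[R]_(m, n)) (e : R) :
  0 <= e -> (forall i j, `|A i j| <= e) -> `|A| <= e.
Proof.
by move=> e0 Ae; rewrite [leLHS]/Num.Def.normr/= mx_normrE; apply: bigmax_le.
Qed.

Lemma derive_coord (V : normedModType R) m n (f : V -> 'M[R]_(m, n)) x v i j :
  differentiable f x ->
  'D_v (fun y => f y i j : R^o) x = 'D_v f x i j.
Proof.
move=> df; apply: (derive_lin (L := @mxcoord R m n i j)) => //.
exact: mx_linear_continuous.
Qed.

Lemma differentiable_coord_comp (V : normedModType R) m n
    (f : V -> 'M[R]_(m, n)) x i j :
  differentiable f x -> differentiable (fun y => f y i j : R^o) x.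
Proof.
move=> df; apply: (@differentiable_comp _ _ _ _ f (@mxcoord R m n i j)) => //.
by apply: linear_differentiable; exact: mx_linear_continuous.
Qed.

Lemma derive_sym_mx (V : normedModType R) m n (A : set V)
    (f : V -> 'M[R]_(m, n)) x u v :
  open A -> A x -> Ck 2 A f -> 'D_v ('D_u f) x = 'D_u ('D_v f) x.
Proof.
move=> oA Ax fC; apply/matrixP => i j.
have d1 w y : A y -> 'D_w (fun y => f y i j : R^o) y = 'D_w f y i j.
  by move=> Ay; apply: derive_coord; exact: Ck_differentiable fC Ay.
have d2 w z : 'D_w ('D_z (fun y => f y i j : R^o)) x = 'D_w ('D_z f) x i j.
  have /CkSP[_ /(_ z) Dz] := fC.
  rewrite -derive_coord; last exact: Ck_differentiable Dz Ax.
  by apply: (open_eq_derive _ oA Ax) => y; rewrite inE; exact: d1.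
have E := derive_sym u v oA Ax (Ck_coord i j oA fC).
exact: etrans (esym (d2 v u)) (etrans E (d2 u v)).
Qed.

(** For each coordinate the mean value theorem applies on the segment. The factor [m] counts the
    partial derivatives, the norm being the maximum of the entries. *)
Lemma lipschitz_ball m n (f : 'rV[R]_m -> 'rV[R]_n) x0 r (e : R) :
  0 <= e ->
  (forall x, ball x0 r x -> differentiable f x) ->
  (forall x i, ball x0 r x -> `|'D_(delta_mx 0 i) f x| <= e) ->
  forall x y, ball x0 r x -> ball x0 r y ->
  `|f x - f y| <= m%:R * e * `|x - y|.
Proof.
move=> e0 df Df x y Bx By; apply: mx_norm_le => [|a j].
  by rewrite !mulr_ge0.
have dseg (t : R) : 0 <= t <= 1 -> differentiable f (t *: (x - y) + y).
  by move=> t1; apply: df; exact: ball_segment.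
have [c c1 cE] := mean_value (fun t t1 => differentiable_coord_comp a j (dseg t
  t1)).
have dc := dseg _ c1; have Bc := ball_segment By Bx c1.
rewrite subrK derive_coord// in cE; rewrite !mxE cE deriveE//.
rewrite [X in 'd f _ X]row_sum_delta linear_sum summxE.
apply: le_trans (ler_norm_sum _ _ _) _.
rewrite -mulrA -[m in m%:R]card_ord -sum1_card natr_sum mulr_suml.
apply: ler_sum => i _; rewrite linearZ/= mxE mul1r normrM mulrC.
apply: ler_pM => //; last exact: mx_coord_le.
by rewrite -deriveE//; apply: le_trans (mx_coord_le _ _ _) _; exact: Df.
Qed.

End InverseFunction.

Section InverseFunction.
Variable R : realType.

Lemma diff_jacobian m n (f : 'rV[R]_m -> 'rV[R]_n) x v :
  'd f x v = v *m 'J f x.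
Proof. by rewrite /jacobian mul_rV_lin1. Qed.

(* [id - F] is a contraction near [x0], its differential at [x0] being 0. *)
Lemma contraction_near m (F : 'rV[R]_m -> 'rV[R]_m) (A : set 'rV[R]_m) x0 :
  open A -> A x0 -> smooth_on A F -> 'J F x0 = 1%:M ->
  exists2 r : R, 0 < r & ball x0 r `<=` A /\
    forall x y, ball x0 r x -> ball x0 r y ->
    `|(x - F x) - (y - F y)| <= 2^-1 * `|x - y|.
Proof.
move=> oA Ax0 FC JF.
pose psi (x : 'rV[R]_m) : 'rV[R]_m := x - F x.
have dF x : A x -> differentiable F x by move=> Ax; exact: smooth_diff FC Ax.
have dpsi x : A x -> is_diff x psi (id - ('d F x : _ -> _)).
  by move=> Ax; apply: is_diffB; exact/differentiableP/dF.
have Dpsi x v : A x -> 'D_v psi x = v - 'D_v F x.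
  move=> Ax; have dv : derivable F x v by exact/diff_derivable/dF.
  by have := deriveB (@derivable_id _ _ x v) dv; rewrite derive_id.
(* Chosen so that [m * e] is at most 1/2; the successor avoids dividing by zero when [m] is 0. *)
pose e : R := (2 * m.+1%:R)^-1.
have e0 : 0 < e by rewrite invr_gt0 mulr_gt0.
have nearD i : \forall x \near (x0 : 'rV[R]_m), `|'D_(delta_mx 0 i) psi x| <= e.
  have Dc : {for x0, continuous ('D_(delta_mx 0 i) F)}.
    by have := smooth_derive (delta_mx 0 i) FC 0%N; exact.
  have nA := open_nbhs_nbhs (conj oA Ax0).
  apply: (filterS _ (filterI nA ((cvgrPdist_lt _ _).1 Dc e e0))) => x [Ax];
    rewrite Dpsi// deriveE; last exact: dF.
  by rewrite diff_jacobian JF mulmx1 => /ltW.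
have nall : \forall x \near x0, A x /\ forall i, `|'D_(delta_mx 0 i) psi x| <=
  e.
  have nA := open_nbhs_nbhs (conj oA Ax0).
  exact: (filterI nA (filter_forall _ nearD)).
have [r /= r0 rP] := (nbhs_ballP _ _).1 nall.
exists r => //; split=> [x /rP[]//|x y Bx By].
have dB z : ball x0 r z -> differentiable psi z by move=> /rP[/dpsi[]].
have DB z i : ball x0 r z -> `|'D_(delta_mx 0 i) psi z| <= e by move=> /rP[_];
  apply.
apply: le_trans (lipschitz_ball (ltW e0) dB DB Bx By) _.
apply: ler_wpM2r => //; rewrite /e invfM mulrCA ler_piMr// ler_pdivrMr//.
by rewrite mul1r ler_nat.
Qed.

(** For [t] near [F x], a preimage of [t] is a fixed point of [z - F z + t], a contraction of a
    closed ball around [x]; Banach's theorem provides it. *)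
Lemma open_image_near_id m (F : 'rV[R]_m -> 'rV[R]_m) (O : set 'rV[R]_m) :
  open O ->
  (forall x y, O x -> O y -> `|(x - F x) - (y - F y)| <= 2^-1 * `|x - y|) ->
  open (F @` O).
Proof.
move=> oO FO; rewrite openE => _ [x Ox <-].
have [s /= s0 sO] := (nbhs_ballP _ _).1 (open_nbhs_nbhs (conj oO Ox)).
pose B : set 'rV[R]_m := closed_ball_ Num.Def.normr x (s / 2).
have sB : B `<=` O.
  move=> z; rewrite /B /closed_ball_ /= => xz; apply: sO.
  by rewrite -ball_normE/=; apply: le_lt_trans xz _;
    rewrite ltr_pdivrMr// ltr_pMr// ltr1n.
(* The closed ball of radius [s / 2] is preserved: contraction contributes at most half of [s / 2],
   and the distance from [t] to [F x] at most [s / 4]. *)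
apply/nbhs_ballP; exists (s / 4) => /=; first by rewrite divr_gt0.
move=> t; rewrite -ball_normE/= => tx.
pose Phi (z : 'rV[R]_m) : 'rV[R]_m := z - F z + t.
have PhiB : {homo Phi : z / B z >-> B z}.
  move=> z; rewrite /B /closed_ball_ /= => xz; rewrite /Phi.
  have -> : x - (z - F z + t) = ((x - F x) - (z - F z)) + (F x - t).
    by rewrite opprD !addrA; congr (_ - _); rewrite addrAC subrK.
  apply: le_trans (ler_normD _ _) _.
  have : `|x - F x - (z - F z)| <= 2^-1 * `|x - z|.
    by apply: FO => //; apply: sB.
  lra.
have ctr : is_contraction (mkfun_fun PhiB).
  exists (2^-1)%:nng; split => /=; first by rewrite invf_lt1// ltr1n.
  move=> [y z] /= [By Bz]; rewrite /mkfun /Phi opprD addrACA subrr addr0.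
  by apply: FO; exact: sB.
have cB : closed B by exact: closed_closed_ball_.
have [|p Bp pE] := banach_fixed_point ctr cB.
  by exists x; rewrite /B /closed_ball_ /= subrr normr0 divr_ge0// ltW.
exists p; first exact: sB.
move: pE; rewrite /= /mkfun /Phi => /eqP; rewrite -subr_eq0.
by rewrite -addrA opprD addrA subrr add0r opprD opprK subr_eq0 => /eqP.
Qed.

End InverseFunction.

Section InverseFunction.
Variable R : realType.

Lemma injective_unitmx n (A : 'M[R]_n) :
  (forall v : 'rV_n, v *m A = 0 -> v = 0) -> A \in unitmx.
Proof.
move=> Ainj; rewrite -row_free_unit -kermx_eq0; apply/eqP/row_matrixP => i.
by rewrite row0; apply: Ainj; rewrite -row_mul mulmx_ker row0.
Qed.

Lemma near_translate m (x : 'rV[R]_m) (O : set 'rV[R]_m) :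
  open O -> O x -> \forall k \near (0 : 'rV[R]_m), O (k + x).
Proof.
move=> oO Ox; have : \forall y \near x, O y by exact: open_nbhs_nbhs.
by rewrite (near_shift (0 : 'rV[R]_m))/= subr0.
Qed.

(** The normalization of the Jacobian suffices, since the straightening map below is built to have
    differential 1 at the base point. *)
Lemma inverse_function_id m (F : 'rV[R]_m -> 'rV[R]_m) (A : set 'rV[R]_m) x0 :
  open A -> A x0 -> smooth_on A F -> 'J F x0 = 1%:M ->
  exists (O : set 'rV[R]_m) (G : 'rV[R]_m -> 'rV[R]_m),
    [/\ open O, O x0, O `<=` A, open (F @` O) &
        (forall x, O x -> G (F x) = x) /\ smooth_on (F @` O) G].
Proof.
move=> oA Ax0 FC JF.
have [r r0 [rA FO]] := contraction_near oA Ax0 FC JF.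
pose O : set 'rV[R]_m := ball x0 r.
have oO : open O by exact: ball_open.
have oFO : open (F @` O) by exact: open_image_near_id.
(* As [id - F] contracts by 1/2, [F] shrinks distances at most by 1/2. This gives injectivity and
   the Lipschitz constant 2 of the inverse. *)
have Flip x y : O x -> O y -> `|x - y| <= 2 * `|F x - F y|.
  move=> Ox Oy; have := FO x y Ox Oy;
    have := ler_normB (x - F x - (y - F y)) (F y - F x).
  have -> : x - F x - (y - F y) - (F y - F x) = x - y.
    by apply/rowP => i; rewrite !mxE; ring.
  rewrite [`|F y - F x|]distrC; lra.
have Finj x y : O x -> O y -> F x = F y -> x = y.
  move=> Ox Oy E; apply/eqP; rewrite -subr_eq0 -normr_le0.
  by have := Flip x y Ox Oy; rewrite E subrr normr0 mulr0.
(* Outside the image of [O] the value of [G] is arbitrary. *)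
have /choice[G GP] : forall t, exists x, (F @` O) t -> O x /\ F x = t.
  move=> t; have [[x Ox <-]|nt] := pselect ((F @` O) t); first by exists x.
  by exists 0.
have GK x : O x -> G (F x) = x.
  move=> Ox; have [] := GP (F x); first by exists x.
  by move=> OG FG; apply: Finj.
(* Along a kernel vector [F] would vary by at most a quarter of a small displacement, against the
   lower bound 1/2 of [Flip]. *)
have JU x : O x -> 'J F x \in unitmx.
  move=> Ox; apply: injective_unitmx => v vJ; apply/eqP; rewrite -normr_le0.
  have dF : differentiable F x by apply: smooth_diff FC _; exact: rA.
  have e0 : (0 : R) < 4^-1 by rewrite invr_gt0.
  have nO : \forall k \near (0 : 'rV[R]_m), O (k + x).
    exact: near_translate.
  have [d /= d0 dP] := (nbhs_ballP _ _).1 (filterI nO (differentiable_eps dF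
    e0)).
  pose s := d / 2 / (`|v| + 1).
  have v0 : 0 < `|v| + 1 by rewrite ltr_wpDl.
  have s0 : 0 < s by rewrite !divr_gt0.
  have sv : `|s *: v| < d.
    have : s * (`|v| + 1) = d / 2 by rewrite divfK// gt_eqF.
    rewrite normrZ (gtr0_norm s0); lra.
  have [|Osv] := dP (s *: v); first by rewrite -ball_normE/= sub0r normrN.
  rewrite diff_jacobian -scalemxAl vJ scaler0 subr0.
  have := Flip _ _ Osv Ox; rewrite addrK normrZ (gtr0_norm s0) => le1 le2.
  rewrite -(pmulr_rle0 _ s0); lra.
have GD t : (F @` O) t -> is_diff t G (mulmxr (invmx ('J F (G t)))).
  move=> Bt; have [Ox Ft] := GP t Bt; set x := G t in Ox Ft *.
  have dF : differentiable F x by apply: smooth_diff FC _; exact: rA.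
  have Lc : continuous (mulmxr (invmx ('J F x)) : 'rV[R]_m -> 'rV[R]_m).
    exact: mx_linear_continuous.
  apply: is_diff_eps => // e e0.
  have [c c0 cP] := linear_lipschitz Lc.
  (* Here [c] bounds the inverse Jacobian and 2 is the Lipschitz constant of [G]; their product is
     compensated in advance. *)
  have e'0 : 0 < e / (2 * c) by rewrite divr_gt0// mulr_gt0.
  have [d /= d0 dP] := (nbhs_ballP _ _).1 (differentiable_eps dF e'0).
  have nB : \forall h \near (0 : 'rV[R]_m), (F @` O) (h + t).
    exact: near_translate.
  have nd : \forall h \near (0 : 'rV[R]_m), `|h| < d / 2.
    by apply: nbhs0_lt; rewrite divr_gt0.
  apply: (filterS _ (filterI nB nd)) => h [/GP[Oy Fy] hd].
  set y := G (h + t) in Oy Fy *; rewrite -/x.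
  have kh : `|y - x| <= 2 * `|h|.
    by apply: le_trans (Flip _ _ Oy Ox) _; rewrite Fy Ft addrK.
  have := dP (y - x); rewrite -ball_normE/= sub0r normrN subrK Fy Ft addrK.
  rewrite diff_jacobian => /(_ _)Hd.
  have -> : y - x - h *m invmx ('J F x) =
      mulmxr (invmx ('J F x)) (- (h - (y - x) *m 'J F x)).
    by rewrite /= opprB mulmxBl mulmxK// JU.
  apply: le_trans (cP _) _; rewrite normrN.
  have {Hd}H : `|h - (y - x) *m 'J F x| <= e / (2 * c) * `|y - x|.
    by apply: Hd; lra.
  have H2 : e / (2 * c) * `|y - x| <= e / (2 * c) * (2 * `|h|).
    by rewrite ler_wpM2l// ltW.
  apply: le_trans (ler_wpM2l (ltW c0) (le_trans H H2)) _.
  suff -> : c * (e / (2 * c) * (2 * `|h|)) = e * `|h| by [].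
  by field; rewrite gt_eqF.
exists O, G; split => //; first exact: ballxx.
(* Bootstrapping: the derivative of [G] is the inverse Jacobian of [F] at [G], hence as regular as
   [G] itself. *)
split => //; elim=> [|k IH].
  move=> t /GD[dG _]; exact: differentiable_continuous.
apply/CkSP; split=> [t /GD[]//|v].
have DC : Ck k (F @` O) (fun t => v *m invmx ('J F (G t))).
  apply: Ck_mulmx => //; first exact: Ck_cst.
  apply: Ck_invmx => //; first by move=> t /GP[Ot _]; exact: JU.
  apply: (@Ck_comp _ _ _ _ _ _ O G (fun x => 'J F x)) => //;
    first by move=> t /GP[].
  by apply: (Ck_sub rA); exact: smooth_jacobian.
apply: (Ck_ext oFO _ DC) => t; rewrite inE => /GD[dG dE].
by rewrite deriveE// dE.
Qed.

End InverseFunction.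

(** * Preimages of submanifolds *)

Section SliceAlgebra.
Variable R : fieldType.

(** [copid_mx k] kills the first [k] coordinates. Lying in a slice or being tangent to it thus
    becomes a linear equation with constant coefficients, which can be differentiated. *)
Lemma pid_copidP p k m (w : 'M[R]_(p, m)) : (k <= m)%N ->
  (exists u : 'M_(p, k), w = u *m pid_mx k) <-> w *m copid_mx k = 0.
Proof.
move=> km; split=> [[u ->]|wC].
  by rewrite -mulmxA mul_pid_mx_copid// mulmx0.
exists (w *m pid_mx k); rewrite -mulmxA mul_pid_mx minnn (minn_idPr _)//.
by move: wC; rewrite mulmxBr mulmx1 => /eqP; rewrite subr_eq0 => /eqP.
Qed.

Lemma surj_row_full m n (A : 'M[R]_(m, n)) :
  (forall w : 'rV_n, exists v : 'rV_m, v *m A = w) -> row_full A.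
Proof.
move=> Asurj; rewrite -sub1mx; apply/row_subP => i.
by have [v <-] := Asurj (row i 1%:M); exact: submxMl.
Qed.

End SliceAlgebra.

Section Straightening.
Variable R : realType.

Lemma Ck_id (V : normedModType R) k (A : set V) : Ck k A id.
Proof.
case: k => [x _|k]; first exact: cvg_id.
apply/CkSP; split=> [x _|v];
  first exact: (@ex_diff _ _ _ _ _ _ _ (is_diff_id x)).
rewrite (_ : 'D_v _ = cst v); first exact: Ck_cst.
by apply/funext => x; exact: derive_id.
Qed.

Lemma derive_mulmxr (V : normedModType R) m n p (f : V -> 'M[R]_(m, n))
    (B : 'M[R]_(n, p)) x v :
  differentiable f x -> 'D_v (fun y => f y *m B) x = 'D_v f x *m B.
Proof.
move=> df; apply: (derive_lin (L := mulmxr B)) => //.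
exact: mx_linear_continuous.
Qed.

Lemma smooth_mulmxr (V : normedModType R) m n p (A : set V)
    (f : V -> 'M[R]_(m, n)) (B : 'M[R]_(n, p)) :
  open A -> smooth_on A f -> smooth_on A (fun y => f y *m B).
Proof. by move=> oA fC k; apply: Ck_mulmx => //; exact: Ck_cst. Qed.

Lemma jacobian_eq m n (f : 'rV[R]_m -> 'rV[R]_n) (x : 'rV[R]_m) (B : 'M[R]_(m,
  n)) :
  differentiable f x -> (forall v, 'D_v f x = v *m B) -> 'J f x = B.
Proof.
move=> df fB; apply/row_matrixP => i.
by rewrite !rowE -fB deriveEjacobian.
Qed.

(* With [C] the differential of the defining equations [f *m copid_mx r] at
   [y] and [C'] its pseudo-inverse, [z |-> z - z C C' + (f z) (copid_mx r) C']
   has differential [1] at [y] and carries the zero set to [kermx C]. *)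
Lemma straighten m n r (f : 'rV[R]_m -> 'rV[R]_n) (A : set 'rV[R]_m) y :
  (r <= n)%N -> open A -> A y -> smooth_on A f -> row_full ('J f y) ->
  let k := (m - (n - r))%N in
  exists (O : set 'rV[R]_m) (F G : 'rV[R]_m -> 'rV[R]_m),
    [/\ open O, O y, O `<=` A & open (F @` O)] /\
    [/\ smooth_on O F, smooth_on (F @` O) G,
        forall z, O z -> G (F z) = z &
        forall z, f z *m copid_mx r = 0 <-> F z *m copid_mx k = 0].
Proof.
move=> rn oA Ay fC fullJ k.
pose C := 'J f y *m copid_mx r.
have CE : (C :=: (copid_mx r : 'M[R]_n))%MS by exact: eqmxMfull.
have rkC : \rank C = (n - r)%N by rewrite CE rank_copid_mx.
pose F0 z : 'rV[R]_m := z *m (1%:M - C *m pinvmx C) + f z *m (copid_mx r *m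
  pinvmx C).
have F0C : smooth_on A F0.
  by move=> j; apply: CkD => //; apply: smooth_mulmxr => // i; exact: Ck_id.
have dfy : differentiable f y by exact: smooth_diff Ay.
have JF0 : 'J F0 y = 1%:M.
  apply: jacobian_eq => [|v]; first exact: smooth_diff Ay.
  rewrite mulmx1 [LHS]deriveD.
  - rewrite derive_mulmxr// derive_mulmxr// derive_id deriveE// diff_jacobian.
    by rewrite mulmxBr mulmx1 !mulmxA subrK.
  - apply: diff_derivable; apply: (@smooth_diff _ _ _ A) => //.
    by apply: smooth_mulmxr => // i; exact: Ck_id.
  - apply: diff_derivable; apply: (@smooth_diff _ _ _ A) => //.
    exact: smooth_mulmxr.
have [U [G0 [Uo Uy UA oFU [G0K G0C]]]] := inverse_function_id oA Ay F0C JF0.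
(* The first [k] rows of [row_ebase (kermx C)] span the kernel of [C], so passing to coordinates in
   that basis turns the kernel into the standard slice. *)
pose S := invmx (row_ebase (kermx C)).
have Su : S \in unitmx by rewrite unitmx_inv row_ebase_unit.
exists U, (fun z => F0 z *m S), (fun w => G0 (w *m invmx S)).
have FSE : (fun z => F0 z *m S) @` U = (fun w => w *m invmx S) @^-1` (F0 @` U).
  apply/seteqP; split=> [_ [z Uz <-]|w [z Uz zw]] /=.
    by rewrite mulmxK//; exists z.
  by exists z => //; rewrite zw mulmxKV.
have oFS : open ((fun z => F0 z *m S) @` U).
  rewrite FSE; apply: open_comp => // w _.
  exact: (@mx_linear_continuous _ _ _ _ (mulmxr (invmx S))).
split; first by split.
split.
- apply: smooth_mulmxr => // j; exact: Ck_sub UA (F0C j).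
- move=> j; apply: (@Ck_comp _ _ _ _ _ _ (F0 @` U)) => //.
    by move=> w; rewrite FSE.
  by apply: smooth_mulmxr => // i; exact: Ck_id.
- by move=> z Uz; rewrite mulmxK// G0K.
- move=> z; transitivity (F0 z *m C = 0).
    (* [C] kills the first summand of [F0], and [pinvmx C *m C] fixes [copid_mx r], whose row space
       is that of [C]. *)
    have F0Cz : F0 z *m C = f z *m copid_mx r.
      have zC : (1%:M - C *m pinvmx C) *m C = 0.
        by rewrite mulmxBl mul1mx mulmxKpV ?subrr.
      have rC : copid_mx r *m pinvmx C *m C = copid_mx r by rewrite mulmxKpV//
        CE.
      by rewrite mulmxDl -[X in X + _]mulmxA zC mulmx0 add0r -mulmxA rC.
    by rewrite F0Cz.
  have rk : \rank (kermx C) = k by rewrite mxrank_ker rkC.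
  rewrite -(pid_copidP _ (leq_subr _ _)) -/k; split.
    move=> /sub_kermxP/submxP[D ->]; rewrite -{1}(mulmx_ebase (kermx C)) rk.
    exists (D *m col_ebase (kermx C) *m pid_mx k).
    by rewrite !mulmxA mulmxK ?row_ebase_unit// -[RHS]mulmxA mul_pid_mx !minnn.
  move=> [u uE]; apply/sub_kermxP; rewrite -[F0 z](mulmxK Su) uE invmxK.
  have -> : (pid_mx k : 'M[R]_(k, m)) = pid_mx k *m (pid_mx k : 'M_m).
    by rewrite mul_pid_mx minnn (minn_idPr (leq_subr _ _)).
  rewrite -!mulmxA.
  have -> : (pid_mx k : 'M_m) *m row_ebase (kermx C) =
      invmx (col_ebase (kermx C)) *m kermx C.
    by rewrite -{3}(mulmx_ebase (kermx C)) rk !mulmxA mulVmx ?mul1mx//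
      col_ebase_unit.
  by do 3!apply: mulmx_sub.
Qed.

End Straightening.

(** * Chart changes and slice charts of a preimage *)

Section Charts.
Variable R : realType.

Lemma chart_image_open (M : topologicalType) m (c : chart R M m) (U : set M) :
  open U -> open (cmap c @` (cdom c `&` U)).
Proof.
move=> oU.
have -> : cmap c @` (cdom c `&` U) = cimg c `&` (cinv c @^-1` U).
  apply/seteqP; split=> [_ [x [cx Ux] <-]|_ [[x cx <-] /= ]]; last first.
    by rewrite cmapK// => Ux; exists x.
  by split; [exists x|rewrite /= cmapK].
rewrite openE => _ [[x cx <-] Ux]; apply: filterI.
  by apply: open_nbhs_nbhs; split; [exact: cimg_open|exists x].
have := @cinv_continuous _ _ _ c (cmap c x); apply; first by exists x.
exact: open_nbhs_nbhs.
Qed.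

Lemma overlap_open (M : topologicalType) m (c c' : chart R M m) :
  open (overlap c c').
Proof. exact/chart_image_open/cdom_open. Qed.

Lemma rep_dom_open m n (M : manifold R m) (N : manifold R n) (phi : M -> N) c d
  :
  continuous phi -> open (rep_dom phi c d).
Proof.
move=> phic; apply: chart_image_open; apply: open_comp => [x _|];
  first exact: phic.
exact: cdom_open.
Qed.

Section ChartChange.
Variables (m : nat) (M : manifold R m) (c : chart R M m).
Variables (W : set 'rV[R]_m) (F G : 'rV[R]_m -> 'rV[R]_m).
Hypotheses (ac : atlas c) (oW : open W) (Wc : W `<=` cimg c)
  (oFW : open (F @` W)) (FC : smooth_on W F) (GC : smooth_on (F @` W) G)
  (GK : forall z, W z -> G (F z) = z).

Let dom : set M := cdom c `&` (cmap c @^-1` W).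

Let dom_open : open dom.
Proof.
rewrite openE => x [cx Wx]; apply: filterI.
  by apply: open_nbhs_nbhs; split=> //; exact: cdom_open.
by apply: (cmap_continuous cx); exact: open_nbhs_nbhs.
Qed.

Let imgE : (F \o cmap c) @` dom = F @` W.
Proof.
apply/seteqP; split=> [_ [x [cx Wx] <-]|_ [z Wz <-]];
  first by exists (cmap c x).
by have [x cx xz] := Wc Wz; exists x; rewrite /= ?xz//; split=> //=; rewrite xz.
Qed.

Let img_open : open ((F \o cmap c) @` dom).
Proof. by rewrite imgE. Qed.

Let mapK x : dom x -> (cinv c \o G) ((F \o cmap c) x) = x.
Proof. by move=> [cx Wx]; rewrite /= GK// cmapK. Qed.

Let map_continuous x : dom x -> {for x, continuous (F \o cmap c)}.
Proof.
move=> [cx Wx]; apply: continuous_comp; first exact: cmap_continuous.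
exact: (FC 0%N).
Qed.

Let inv_continuous y :
  ((F \o cmap c) @` dom) y -> {for y, continuous (cinv c \o G)}.
Proof.
rewrite imgE => Wy; apply: continuous_comp; first exact: (GC 0%N).
by move: Wy => [z Wz <-]; rewrite GK//; apply: cinv_continuous; exact: Wc.
Qed.

Definition changed_chart : chart R M m :=
  Chart dom_open img_open mapK map_continuous inv_continuous.

(** The transitions with any chart of the atlas are those of [c] composed with [F] or [G], so
    maximality of the atlas applies. *)
Lemma changed_chart_atlas : atlas changed_chart.
Proof.
apply: atlas_max => c' ac'; split=> k.
- apply: (@Ck_comp _ _ _ _ _ _ (overlap c c') G (transition c c')) => //.
  + exact: overlap_open.
  + move=> _ [x [[cx Wx] c'x] <-]; rewrite /= GK//.
    by exists x.
  + apply: Ck_sub (GC k) => _ [x [[cx Wx] c'x] <-].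
    by exists (cmap c x).
  + exact: atlas_compat.
- apply: (@Ck_comp _ _ _ _ _ _ W (transition c' c) F) => //.
  + exact: overlap_open.
  + by move=> _ [x [c'x [cx Wx]] <-]; rewrite /transition/= cmapK.
  + apply: Ck_sub (atlas_compat ac' ac k) => _ [x [c'x [cx Wx]] <-].
    by exists x.
Qed.

End ChartChange.

Lemma rep_in_slice m n (M : manifold R m) (N : manifold R n) (phi : M -> N)
    (c : chart R M m) (d : chart R N n) x :
  cdom c x -> rep phi c d (cmap c x) = cmap d (phi x).
Proof. by move=> cx; rewrite /rep/= cmapK. Qed.

(** Surjectivity of the differential lets the slice equations of [P], pulled back by the map, be
    straightened around each point; the codimension [n - r] is preserved. *)
Lemma submersion_preimage m n r (M : manifold R m) (N : manifold R n)
    (phi : M -> N) (P : set N) :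
  submersion phi -> submanifold r P ->
  submanifold (m - (n - r)) (phi @^-1` P).
Proof.
move=> [[phic phiC] phiS] subP x Px.
have [d [ad rn dP] dx] := subP _ Px.
have [c ac cx] := atlas_cover x.
set f := rep phi c d; set A := rep_dom phi c d.
have oA : open A by exact: rep_dom_open.
have Ax : A (cmap c x) by exists x.
have fullJ : row_full ('J f (cmap c x)).
  apply: surj_row_full => w; have [v vw] := phiS c d ac ad _ Ax w.
  by exists v; rewrite -diff_jacobian.
have [W [F [G [[oW Wx WA oFW] [FC GC GK FP]]]]] :=
  straighten rn oA Ax (phiC c d ac ad) fullJ.
have Wc : W `<=` cimg c by move=> z /WA[y [cy _] <-]; exists y.
exists (changed_chart oW Wc oFW FC GC GK); last by split.
split; [exact: changed_chart_atlas|exact: leq_subr|].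
move=> y [cy Wy] /=.
have dy : cdom d (phi y).
  by have [z [cz dz] zy] := WA _ Wy; rewrite -(cmapK cy) -zy cmapK.
rewrite (dP _ dy) (pid_copidP _ rn) (pid_copidP _ (leq_subr _ _)) -FP.
by rewrite /f rep_in_slice.
Qed.

End Charts.

(** * Contractions of bilinear forms *)

Section Contraction.
Variable R : realType.

Definition bilin a b n (B : 'rV[R]_a -> 'rV[R]_b -> 'rV[R]_n) : Prop :=
  (forall t u u' v, B (t *: u + u') v = t *: B u v + B u' v) /\
  (forall t u v v', B u (t *: v + v') = t *: B u v + B u v').

(** As [gtrace], with an arbitrary contravariant 2-tensor in place of the inverse metric. It may be
    degenerate, as the cometric of a subspace is. *)
Definition contract m n (S : 'M[R]_m) (B : 'rV[R]_m -> 'rV[R]_m -> 'rV[R]_n) :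
    'rV[R]_n :=
  \sum_(i < m) \sum_(j < m) S i j *: B (delta_mx 0 i) (delta_mx 0 j).

Lemma gtraceE m n (A : 'M[R]_m) (B : 'rV[R]_m -> 'rV[R]_m -> 'rV[R]_n) :
  gtrace A B = contract (invmx A) B.
Proof. by []. Qed.

Lemma linear_row_sum m n (L : 'rV[R]_m -> 'rV[R]_n) :
  (forall t u u', L (t *: u + u') = t *: L u + L u') ->
  forall u, L u = \sum_i u 0 i *: L (delta_mx 0 i).
Proof.
move=> Llin u.
have L0 : L 0 = 0.
  by have := Llin (-1) 0 0; rewrite scaler0 addr0 scaleN1r addNr.
rewrite [in LHS](row_sum_delta u).
by elim/big_rec2: _ => [//|i x y _ <-]; rewrite Llin.
Qed.

Lemma bilinE a b n (B : 'rV[R]_a -> 'rV[R]_b -> 'rV[R]_n) : bilin B ->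
  forall u v, B u v =
    \sum_i \sum_j (u 0 i * v 0 j) *: B (delta_mx 0 i) (delta_mx 0 j).
Proof.
move=> [Bl Br] u v; rewrite (@linear_row_sum _ _ (B ^~ v)); last first.
  by move=> t w w'; rewrite Bl.
apply: eq_bigr => i _; rewrite (@linear_row_sum _ _ (B _)); last first.
  by move=> t w w'; rewrite Br.
by rewrite scaler_sumr; apply: eq_bigr => j _; rewrite scalerA.
Qed.

Lemma bilin_mulmxr a b n p (B : 'rV[R]_a -> 'rV[R]_b -> 'rV[R]_n)
    (C : 'M[R]_(n, p)) :
  bilin B -> bilin (fun u v => B u v *m C).
Proof.
move=> [Bl Br]; split=> [t u u' v|t u v v'].
  by rewrite Bl mulmxDl scalemxAl.
by rewrite Br mulmxDl scalemxAl.
Qed.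

Lemma bilin_comp a b n (B : 'rV[R]_b -> 'rV[R]_b -> 'rV[R]_n)
    (X : 'M[R]_(a, b)) :
  bilin B -> bilin (fun u v => B (u *m X) (v *m X)).
Proof.
move=> [Bl Br]; split=> [t u u' v|t u v v'].
  by rewrite mulmxDl -scalemxAl Bl.
by rewrite mulmxDl -scalemxAl Br.
Qed.

(** Duality: pushing the tensor forward by [X] amounts to pulling the form back. This restricts
    contractions to subspaces and transports them along differentials. *)
Lemma contract_congr a m n (T : 'M[R]_a) (X : 'M[R]_(a, m))
    (B : 'rV[R]_m -> 'rV[R]_m -> 'rV[R]_n) : bilin B ->
  contract (X^T *m T *m X) B = contract T (fun u v => B (u *m X) (v *m X)).
Proof.
move=> Bb; rewrite /contract.
transitivity (\sum_c \sum_d \sum_i \sum_j (T c d * (X c i * X d j)) *: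
    B (delta_mx 0 i) (delta_mx 0 j)); last first.
  apply: eq_bigr => c _; apply: eq_bigr => d _;
    rewrite [in RHS]bilinE// scaler_sumr.
  apply: eq_bigr => i _; rewrite scaler_sumr; apply: eq_bigr => j _.
  by rewrite scalerA -!rowE !mxE.
transitivity (\sum_i \sum_j \sum_c \sum_d (T c d * (X c i * X d j)) *:
    B (delta_mx 0 i) (delta_mx 0 j)).
  apply: eq_bigr => i _; apply: eq_bigr => j _.
  rewrite exchange_big mxE scaler_suml; apply: eq_bigr => d _.
  rewrite mxE -scaler_suml mulr_suml -scaler_suml; congr (_ *: _).
  rewrite -[LHS]/(_ * _) mulr_suml; apply: eq_bigr => c _; rewrite !mxE; ring.
under eq_bigr do rewrite exchange_big; rewrite exchange_big/=.
apply: eq_bigr => c _.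
under eq_bigr do rewrite exchange_big; rewrite exchange_big/=.
by [].
Qed.

Lemma contractDl m n (S S' : 'M[R]_m) (B : 'rV[R]_m -> 'rV[R]_m -> 'rV[R]_n) :
  contract (S + S') B = contract S B + contract S' B.
Proof.
rewrite /contract -big_split; apply: eq_bigr => i _; rewrite -big_split.
by apply: eq_bigr => j _; rewrite mxE scalerDl.
Qed.

Lemma contractD m n (S : 'M[R]_m) (B B' : 'rV[R]_m -> 'rV[R]_m -> 'rV[R]_n) :
  contract S (fun u v => B u v + B' u v) = contract S B + contract S B'.
Proof.
rewrite /contract -big_split; apply: eq_bigr => i _; rewrite -big_split.
by apply: eq_bigr => j _; rewrite scalerDr.
Qed.

Lemma contract_mul m n p (S : 'M[R]_m) (F : 'M[R]_(n, p))
    (B : 'rV[R]_m -> 'rV[R]_m -> 'rV[R]_n) :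
  contract S (fun u v => B u v *m F) = contract S B *m F.
Proof.
rewrite /contract mulmx_suml; apply: eq_bigr => i _; rewrite mulmx_suml.
by apply: eq_bigr => j _; rewrite scalemxAl.
Qed.

Lemma contractN m n (S : 'M[R]_m) (B : 'rV[R]_m -> 'rV[R]_m -> 'rV[R]_n) :
  contract S (fun u v => - B u v) = - contract S B.
Proof.
rewrite /contract -sumrN; apply: eq_bigr => i _; rewrite -sumrN.
by apply: eq_bigr => j _; rewrite scalerN.
Qed.

Lemma eq_contract m n (S : 'M[R]_m) (B B' : 'rV[R]_m -> 'rV[R]_m -> 'rV[R]_n) :
  (forall u v, B u v = B' u v) -> contract S B = contract S B'.
Proof.
by move=> BB'; apply: eq_bigr => i _; apply: eq_bigr => j _; rewrite BB'.
Qed.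

(** Moving [J] from the tensor to the form shows that the contraction equals its own opposite. Both
    contractions of the main argument vanish in this way. *)
Lemma contract_anti m n (T J : 'M[R]_m)
    (B : 'rV[R]_m -> 'rV[R]_m -> 'rV[R]_n) :
  bilin B -> J^T *m T *m J = T ->
  (forall u v, B (u *m J) (v *m J) = - B u v) -> contract T B = 0.
Proof.
move=> Bb JT BJ; apply/eqP; have /eqP : contract T B = - contract T B.
  by rewrite -{1}JT contract_congr// (eq_contract _ BJ) contractN.
by rewrite -addr_eq0 -mulr2n -scaler_nat scaler_eq0 pnatr_eq0.
Qed.

End Contraction.

(** * Cometrics and complex structures *)

Section HermitianAlgebra.
Variable R : fieldType.

(** As [J] squares to -1, invariance is rewritten as a skew commutation rule, a form that passes to
    inverses and lets [J] move through products. *)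
Lemma skewl n (J K X : 'M[R]_n) :
  J *m J = - 1%:M -> J *m X *m K = X -> X *m K = - (J *m X).
Proof.
by move=> JJ JX; rewrite -{2}JX !mulmxA JJ !mulNmx mul1mx opprK.
Qed.

Lemma skew_inv n (J K X : 'M[R]_n) : X \in unitmx ->
  X *m K = - (J *m X) -> invmx X *m J = - (K *m invmx X).
Proof.
move=> Xu XK; apply: (can_inj (mulmxK Xu)); apply: (can_inj (mulKmx Xu)).
rewrite -!mulmxA mulKVmx// mulNmx -mulmxA mulVmx// mulmx1 mulmxN XK opprK.
by [].
Qed.

(* At a point of [K]: [G], [H], [J] are the metrics and the complex structure,
  [F]
   is the differential of the map, and the rows of [E] and [E'] span the tangent
   spaces of [K] and [P].  [Ga] is the cometric pushed forward by [F], [S] the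
   cometric of [K], and [E'^T *m s0 *m E'] the image of [S] under [F]. *)
Section Fibre.
Variables (m n r k : nat) (G : 'M[R]_m) (H J : 'M[R]_n) (F : 'M[R]_(m, n))
  (E : 'M[R]_(k, m)) (E' : 'M[R]_(r, n)).
Hypotheses (Gu : G \in unitmx) (Hu : H \in unitmx)
  (Gk_unit : E *m G *m E^T \in unitmx)
  (Gsym : G^T = G) (Hsym : H^T = H)
  (JJ : J *m J = - 1%:M) (JHJ : J *m H *m J^T = H)
  (E'K : E' *m E'^T = 1%:M).

Let Ga := F^T *m invmx G *m F.
Hypothesis Gau : Ga \in unitmx.
Hypothesis JP : J *m (H *m Ga) = H *m Ga *m J.

Variables (Phi : 'M[R]_(k, r)) (J' : 'M[R]_r).
Hypotheses (EF : E *m F = Phi *m E') (E'J : E' *m J = J' *m E').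
Hypothesis tangentP : forall v : 'rV_m,
  (v *m F <= E')%MS -> (v <= E)%MS.

Let S := E^T *m invmx (E *m G *m E^T) *m E.
Let s0 := Phi^T *m invmx (E *m G *m E^T) *m Phi.

Let HJ : H *m J^T = - (J *m H).
Proof. exact: skewl. Qed.

Let VHJ : invmx H *m J = - (J^T *m invmx H).
Proof. exact: skew_inv. Qed.

Let GaJ : Ga *m J = - (J^T *m Ga).
Proof.
apply: (can_inj (mulKmx Hu));
  rewrite mulmxA -JP mulmxN [H *m (J^T *m _)]mulmxA HJ mulNmx opprK.
by rewrite mulmxA.
Qed.

Let VGaJ : invmx Ga *m J^T = - (J *m invmx Ga).
Proof. exact: skew_inv. Qed.

Let sE : F^T *m S *m F = E'^T *m s0 *m E'.
Proof.
rewrite /S /s0 !mulmxA -trmx_mul EF -[RHS]mulmxA -!mulmxA EF.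
by rewrite trmx_mul !mulmxA.
Qed.

Let J'J' : J' *m J' = - 1%:M.
Proof.
have : J' *m J' *m E' = - E' by rewrite -mulmxA -E'J mulmxA -E'J -mulmxA JJ
  mulmxN mulmx1.
by move=> /(congr1 (mulmx ^~ E'^T)); rewrite -mulmxA E'K mulmx1 mulNmx E'K.
Qed.

(** The factor in parentheses is the horizontal lift: following it by [F] gives the identity.
    Vectors tangent to [P] therefore lift into the tangent space of [K]. *)
Let lift_tangent : exists L, E' *m (invmx Ga *m F^T *m invmx G) = L *m E.
Proof.
apply/submxP; apply/row_subP => i; rewrite row_mul; apply: tangentP.
by rewrite -mulmxA -mulmxA -[_ *m F]mulmxA -/Ga mulVmx// mulmx1 row_sub.
Qed.

(* [s0] is inverse to the restriction of [invmx Ga] to the rows of [E']. *)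
Let s0_inv : E' *m invmx Ga *m E'^T *m s0 = 1%:M.
Proof.
have [L LE] := lift_tangent.
(* On the lifts [L *m E], which are tangent to [K], multiplication by [G *m S] is the identity. *)
have H1 : E' *m invmx Ga *m (E'^T *m s0 *m E') = E'.
  rewrite -sE.
  have -> : E' *m invmx Ga *m (F^T *m S *m F) =
      E' *m (invmx Ga *m F^T *m invmx G) *m G *m S *m F.
    by rewrite !mulmxA mulmxKV.
  rewrite LE.
  have -> : L *m E *m G *m S *m F =
      L *m (E *m G *m E^T *m invmx (E *m G *m E^T)) *m E *m F.
    by rewrite /S !mulmxA.
  rewrite mulmxV// mulmx1 -LE -!mulmxA.
  by rewrite [F^T *m _]mulmxA -/Ga mulVmx// mulmx1.
move: H1 => /(congr1 (mulmx ^~ E'^T)); rewrite -!mulmxA E'K mulmx1 => <-.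
by rewrite !mulmxA.
Qed.

(** The inverse of [s0] is the restriction of a [J]-invariant form to a [J]-stable subspace, and
    invariance passes to inverses. *)
Lemma sigma0_invariant : J'^T *m s0 *m J' = s0.
Proof.
pose X := E' *m invmx Ga *m E'^T.
have XJ : X *m J'^T = - (J' *m X).
  have -> : X *m J'^T = E' *m (invmx Ga *m J^T) *m E'^T.
    by rewrite /X -mulmxA -trmx_mul -E'J trmx_mul !mulmxA.
  by rewrite VGaJ mulmxN mulNmx /X !mulmxA E'J.
have Xs : X *m s0 = 1%:M by exact: s0_inv.
move: X XJ Xs => X XJ Xs.
(* Both [s0] and its transform under [J'] are inverse to [X], hence equal. *)
have XY : X *m (J'^T *m s0 *m J') = 1%:M.
  by rewrite mulmxA mulmxA XJ !mulNmx -(mulmxA J' X s0) Xs mulmx1 J'J' opprK.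
by rewrite -[LHS]mul1mx -(mulmx1C Xs) -(mulmxA s0 X) XY mulmx1.
Qed.

Lemma sigmaE : F^T *m S *m F = E'^T *m s0 *m E'.
Proof. exact: sE. Qed.

Let sJ : J^T *m (F^T *m S *m F) *m J = F^T *m S *m F.
Proof.
rewrite sE; move: sigma0_invariant; move: s0 => s1 s1J.
transitivity ((E' *m J)^T *m s1 *m (E' *m J));
  first by rewrite trmx_mul !mulmxA.
rewrite E'J trmx_mul -[in RHS]s1J.
by rewrite !mulmxA.
Qed.

Let GaS := Ga - F^T *m S *m F.

Let GaSJ : GaS *m J = - (J^T *m GaS).
Proof.
rewrite /GaS mulmxBl mulmxBr GaJ opprB addrC; congr (_ - _).
by rewrite -[X in X *m J]sJ -mulmxA JJ mulmxN mulmx1 opprK.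
Qed.

(** The second factor is the orthogonal projection onto the kernel of [F]. That kernel is tangent to
    [K], while [invmx G - S] is supported on the normal space. *)
Let normal_kernel : (invmx G - S) *m
  (1%:M - F *m invmx Ga *m F^T *m invmx G) = 0.
Proof.
pose Pi := F *m invmx Ga *m F^T *m invmx G.
have PiF : (1%:M - Pi) *m F = 0.
  by rewrite mulmxBl mul1mx /Pi -!mulmxA [F^T *m _]mulmxA -/Ga mulVmx// mulmx1
    subrr.
have /submxP[Z ZE] : (1%:M - Pi <= E)%MS.
  by apply/row_subP => i; apply: tangentP; rewrite -row_mul PiF row0 sub0mx.
have GaT : Ga^T = Ga by rewrite /Ga !trmx_mul trmxK trmx_inv Gsym mulmxA.
have PiG : (1%:M - Pi) *m G = G *m (1%:M - Pi)^T.
  rewrite mulmxBl linearB/= trmx1 mulmxBr mul1mx mulmx1; congr (_ - _).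
  rewrite /Pi !trmx_mul trmxK !trmx_inv Gsym GaT mulmxKV// !mulmxA.
  by rewrite mulmxV// mul1mx.
apply: (can_inj (mulmxK Gu));
  rewrite mul0mx -/Pi -(mulmxA (invmx G - S)) PiG ZE trmx_mul.
rewrite mulmxBl mulKmx//.
have -> : S *m (G *m (E^T *m Z^T)) =
    E^T *m (invmx (E *m G *m E^T) *m (E *m G *m E^T)) *m Z^T.
  by rewrite /S !mulmxA.
by rewrite mulVmx// mulmx1 subrr.
Qed.

(** The normal space of [K] is horizontal, so its cometric comes from a tensor on the target through
    the matrix [H *m F^T *m invmx G] of the adjoint. *)
Lemma normal_cometric :
  exists2 T, J^T *m T *m J = T &
    invmx G - S = (H *m F^T *m invmx G)^T *m T *m (H *m F^T *m invmx G).
Proof.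
set D := H *m F^T *m invmx G;
  have VHu : invmx H \in unitmx by rewrite unitmx_inv.
have GT : (invmx G)^T = invmx G by rewrite trmx_inv Gsym.
(* Multiplying the wanted identity by [F^T] on the left and [F] on the right gives
   [GaS = Ga *m H *m T *m H *m Ga], which is solved for [T]. *)
exists (invmx H *m invmx Ga *m GaS *m invmx Ga *m invmx H).
  (* [J^T] crosses the five factors of [T], alternating with [J] and changing sign each time; the
     remaining [J *m J] supplies the sixth sign. *)
  have JVH : J^T *m invmx H = - (invmx H *m J) by rewrite VHJ opprK.
  have JVGa : J *m invmx Ga = - (invmx Ga *m J^T) by rewrite VGaJ opprK.
  have JGaS : J^T *m GaS = - (GaS *m J) by rewrite GaSJ opprK.
  rewrite !mulmxA JVH !mulNmx -[invmx H *m J *m _]mulmxA JVGa mulmxN !mulNmx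
    opprK.
  rewrite !mulmxA -[_ *m J^T *m GaS]mulmxA JGaS mulmxN !mulNmx.
  rewrite !mulmxA -[_ *m J *m invmx Ga]mulmxA JVGa mulmxN !mulNmx opprK.
  rewrite !mulmxA -[_ *m J^T *m invmx H]mulmxA JVH mulmxN !mulNmx.
  by rewrite !mulmxA -[_ *m J *m J]mulmxA JJ mulmxN mulmx1 opprK.
have ST : S^T = S.
  by rewrite /S !trmx_mul trmxK trmx_inv !trmx_mul trmxK Gsym !mulmxA.
pose Pi := F *m invmx Ga *m F^T *m invmx G.
have SPi : (invmx G - S) *m Pi = invmx G - S.
  apply/eqP; rewrite -subr_eq0 -oppr_eq0 opprB -{1}[invmx G - S]mulmx1 -mulmxBr.
  by apply/eqP; exact: normal_kernel.
have PiS : Pi^T *m (invmx G - S) = invmx G - S.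
  have SS : (invmx G - S)^T = invmx G - S by rewrite linearB/= GT ST.
  by rewrite -{1}SS -trmx_mul SPi SS.
rewrite -{1}PiS -{1}SPi.
have GaT : Ga^T = Ga by rewrite /Ga !trmx_mul trmxK GT mulmxA.
have -> : D^T *m (invmx H *m invmx Ga *m GaS *m invmx Ga *m invmx H) *m D =
    invmx G *m F *m (H *m invmx H) *m invmx Ga *m GaS *m invmx Ga *m
    (invmx H *m H) *m F^T *m invmx G.
  by rewrite /D !trmx_mul trmxK GT Hsym !mulmxA.
rewrite mulmxV// mulVmx// !mulmx1.
have -> : GaS = F^T *m (invmx G - S) *m F by rewrite mulmxBr mulmxBl.
by rewrite /Pi !trmx_mul trmxK (trmx_inv Ga) GaT GT !mulmxA.
Qed.

End Fibre.

End HermitianAlgebra.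

(** * Christoffel symbols *)

Section LocalGeometry.
Variable R : realType.

Lemma derive_mulmxl (V : normedModType R) m n p (f : V -> 'M[R]_(n, p))
    (B : 'M[R]_(m, n)) x v :
  differentiable f x -> 'D_v (fun y => B *m f y) x = B *m 'D_v f x.
Proof.
move=> df; apply: (derive_lin (L := mulmx B)) => //.
exact: mx_linear_continuous.
Qed.

Lemma differentiable_mulmx (V : normedModType R) m n p (f : V -> 'M[R]_(m, n))
    (g : V -> 'M[R]_(n, p)) x :
  differentiable f x -> differentiable g x ->
  differentiable (fun y => f y *m g y) x.
Proof.
move=> df dg; apply: (differentiable_bilin2 (B := @mulmx R m n p)) => //.
exact: mx_bilinear_continuous.
Qed.

Lemma derive_mulmx (V : normedModType R) m n p (f : V -> 'M[R]_(m, n))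
    (g : V -> 'M[R]_(n, p)) x v :
  differentiable f x -> differentiable g x ->
  'D_v (fun y => f y *m g y) x = 'D_v f x *m g x + f x *m 'D_v g x.
Proof.
move=> df dg; apply: (derive_bilin (B := @mulmx R m n p)) => //.
exact: mx_bilinear_continuous.
Qed.

Lemma derive_ip (V : normedModType R) m (G : V -> 'M[R]_m) x u v w :
  differentiable G x ->
  'D_u (fun y => ip (G y) v w : R^o) x = ip ('D_u G x) v w.
Proof.
move=> dG; have dvG : differentiable (fun y => v *m G y) x.
  by apply: differentiable_mulmx => //; exact: differentiable_cst.
have dvGw : differentiable (fun y => v *m G y *m w^T) x.
  by apply: differentiable_mulmx => //; exact: differentiable_cst.
rewrite /ip (derive_coord _ 0 0 dvGw).
by rewrite (derive_mulmxr _ _ dvG) (derive_mulmxl _ _ dG).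
Qed.

Lemma ip_delta m (A : 'M[R]_m) i j : ip A (delta_mx 0 i) (delta_mx 0 j) = A i j.
Proof. by rewrite /ip -rowE trmx_delta -colE !mxE. Qed.

Lemma ip_inj m (A A' : 'M[R]_m) : (forall u v, ip A u v = ip A' u v) -> A = A'.
Proof. by move=> AA; apply/matrixP => i j; rewrite -!ip_delta. Qed.

Lemma ip_trmx m (A : 'M[R]_m) u v : ip A^T u v = ip A v u.
Proof.
have -> : ip A^T u v = (u *m A^T *m v^T)^T 0 0 by rewrite mxE.
by rewrite !trmx_mul !trmxK mulmxA.
Qed.

Lemma ip_sym_trmx m (A : 'M[R]_m) :
  (forall u v, ip A u v = ip A v u) -> A^T = A.
Proof. by move=> As; apply: ip_inj => u v; rewrite ip_trmx. Qed.

Section Christoffel.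
Variables (m : nat) (G : 'rV[R]_m -> 'M[R]_m) (x : 'rV[R]_m).
Hypothesis dG : differentiable G x.

Lemma ipPl (A : 'M[R]_m) t u u' v : ip A (t *: u + u') v = t * ip A u v + ip A
  u' v.
Proof. by rewrite /ip !mulmxDl -!scalemxAl mxE mxE. Qed.

Lemma ipPr (A : 'M[R]_m) t u v v' : ip A u (t *: v + v') = t * ip A u v + ip A
  u v'.
Proof. by rewrite /ip linearP/= mulmxDr -scalemxAr mxE mxE. Qed.

Lemma ipPm (A A' : 'M[R]_m) t u v : ip (t *: A + A') u v = t * ip A u v + ip A'
  u v.
Proof. by rewrite /ip mulmxDr -scalemxAr mulmxDl -scalemxAl mxE mxE. Qed.

Lemma derive_dirP (W : normedModType R) (g : 'rV[R]_m -> W) t u u' :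
  differentiable g x -> 'D_(t *: u + u') g x = t *: 'D_u g x + 'D_u' g x.
Proof. by move=> dg; rewrite deriveDv// deriveZv. Qed.

(** Koszul's expression with an arbitrary [D] for the derivative of the metric, so that bilinearity
    and symmetry become pure algebra. *)
Let koszul (D : 'rV[R]_m -> 'M[R]_m) (u v : 'rV[R]_m) : 'rV[R]_m :=
  \row_l (2^-1 * (ip (D u) v (delta_mx 0 l) + ip (D v) u (delta_mx 0 l)
    - ip (D (delta_mx 0 l)) u v)).

Let koszul_bilin D :
  (forall t u u', D (t *: u + u') = t *: D u + D u') -> bilin (koszul D).
Proof.
move=> DP; have three (t a b c a' b' c' : R) :
    2^-1 * ((t * a + a') + (t * b + b') - (t * c + c'))
    = t * (2^-1 * (a + b - c)) + 2^-1 * (a' + b' - c') by ring.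
split=> [t u u' v|t u v v']; apply/rowP => l; rewrite !mxE DP.
  by rewrite ipPm !ipPl three.
by rewrite ipPm ipPl ipPr three.
Qed.

Let koszul_sym D u v : (forall w a b, ip (D w) a b = ip (D w) b a) ->
  koszul D u v = koszul D v u.
Proof.
move=> Ds; apply/rowP => l.
by rewrite !mxE (Ds _ u v); congr (_ * (_ - _)); rewrite addrC.
Qed.

Let christoffelE u v :
  christoffel G x u v = koszul (fun w => 'D_w G x) u v *m invmx (G x).
Proof.
congr (_ *m _); apply/rowP => l; rewrite !mxE.
by congr (_ * (_ + _ - _)); exact: derive_ip.
Qed.

Lemma christoffel_bilin : bilin (christoffel G x).
Proof.
have [kl kr] : bilin (koszul (fun w => 'D_w G x)).
  by apply: koszul_bilin => t u u'; exact: derive_dirP.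
split=> [t u u' v|t u v v']; rewrite !christoffelE ?kl ?kr mulmxDl.
  by rewrite -scalemxAl.
by rewrite -scalemxAl.
Qed.

Lemma christoffel_sym (A : set 'rV[R]_m) : open A -> A x ->
  (forall y, A y -> forall u v, ip (G y) u v = ip (G y) v u) ->
  forall u v, christoffel G x u v = christoffel G x v u.
Proof.
move=> oA Ax Gs u v.
have Ds w a b : ip ('D_w G x) a b = ip ('D_w G x) b a.
  rewrite -(derive_ip w a b dG) -(derive_ip w b a dG).
  by apply: (open_eq_derive _ oA Ax) => y; rewrite inE => Ay; exact: Gs.
rewrite !christoffelE; congr (_ *m _); exact: koszul_sym.
Qed.

End Christoffel.

Lemma posdef_unitmx m (A : 'M[R]_m) :
  (forall u, u != 0 -> 0 < ip A u u) -> A \in unitmx.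
Proof.
move=> Apos; apply: injective_unitmx => v vA; apply/eqP/contraT => /Apos.
by rewrite /ip vA mul0mx mxE ltxx.
Qed.

(* Only the restriction of [h] to the affine line through [y] matters. *)
Lemma derive_along_eq0 (V W : normedModType R) (A : set V) (h : V -> W) y v :
  open A -> A y -> differentiable h y ->
  (forall t : R, A (t *: v + y) -> h (t *: v + y) = 0) -> 'D_v h y = 0.
Proof.
move=> oA Ay dh h0.
have dh0 : differentiable h ((0 : R) *: v + y) by rewrite scale0r add0r.
have [_] := is_derive_segment dh0; rewrite scale0r add0r => <-.
rewrite -(derive_cst (0 : W) (0 : R) (1 : R)); apply: near_eq_derive.
have cl : {for (0 : R), continuous (fun t : R => t *: v + y)}.
  apply: continuousD; last exact: cst_continuous.
  exact: scalel_continuous.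
have nA : nbhs ((0 : R) *: v + y) A.
  by rewrite scale0r add0r; exact: open_nbhs_nbhs.
near=> t; apply: h0; near: t; exact: (cl A nA).
Unshelve. all: by end_near. Qed.

End LocalGeometry.

(** * The second fundamental form of the preimage *)

Section LocalEquation.
Variable R : realType.
Variables (m n r : nat) (A : set 'rV[R]_m) (B : set 'rV[R]_n).
Variables (G : 'rV[R]_m -> 'M[R]_m) (H J : 'rV[R]_n -> 'M[R]_n).
Variables (f : 'rV[R]_m -> 'rV[R]_n) (y : 'rV[R]_m).
Hypotheses (oA : open A) (oB : open B) (Ay : A y) (fAB : forall z, A z -> B (f
  z)).
Hypotheses (GC : smooth_on A G) (HC : smooth_on B H) (JC : smooth_on B J)
  (fC : smooth_on A f).
Hypotheses (Gsym : forall z, A z -> forall u v, ip (G z) u v = ip (G z) v u)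
  (Gpos : forall z, A z -> forall u, u != 0 -> 0 < ip (G z) u u)
  (Hsym : forall z, B z -> forall u v, ip (H z) u v = ip (H z) v u)
  (Hpos : forall z, B z -> forall u, u != 0 -> 0 < ip (H z) u u)
  (JJ : forall z, B z -> J z *m J z = - 1%:M)
  (JHJ : forall z, B z -> forall u v, ip (H z) (u *m J z) (v *m J z) = ip (H z)
    u v).
Hypothesis JK : forall z, B z -> forall w v,
  cov H (fun z' => w *m J z') z v = cov H (fun=> w) z v *m J z.
Hypothesis fphwc : forall z, A z -> forall w,
  'd f z (adjoint G H f z (w *m J (f z))) = 'd f z (adjoint G H f z w) *m J (f
    z).
Hypothesis fphh : forall w w',
  'd f y (cov G (fun z => adjoint G H f z (w' *m J (f z))) y (adjoint G H f y
    w))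
  = 'd f y (cov G (fun z => adjoint G H f z w') y (adjoint G H f y w)) *m J (f
    y).
Hypothesis ffull : row_full ('J f y).

Let F := 'J f y.
(** The matrix of the adjoint at [z]; as a product of smooth matrix fields it is differentiated by
    the Leibniz rule. *)
Let D z : 'M[R]_(n, m) := H (f z) *m ('J f z)^T *m invmx (G z).

Let adjE z (w : 'rV[R]_n) : adjoint G H f z w = w *m D z.
Proof. by rewrite /adjoint /D !mulmxA. Qed.

Let By : B (f y). Proof. exact: fAB. Qed.

Let Gu z : A z -> G z \in unitmx.
Proof. by move=> Az; apply: posdef_unitmx; exact: Gpos. Qed.

Let dG : differentiable G y. Proof. exact: smooth_diff GC Ay. Qed.
Let dH : differentiable H (f y). Proof. exact: smooth_diff HC By. Qed.
Let dJ : differentiable J (f y). Proof. exact: smooth_diff JC By. Qed.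
Let df : differentiable f y. Proof. exact: smooth_diff fC Ay. Qed.

Let jfC : smooth_on A (fun z => 'J f z).
Proof. exact: smooth_jacobian. Qed.
Let djf : differentiable (fun z => 'J f z) y. Proof. exact: smooth_diff jfC Ay.
  Qed.

Let DC : smooth_on A D.
Proof.
move=> k; apply: Ck_mulmx => //; last first.
  by apply: Ck_invmx => //; exact: GC.
apply: Ck_mulmx => //; first exact: (Ck_comp oA fAB (fC k) (HC k)).
by apply: Ck_trmx => //; exact: jfC.
Qed.

Lemma adjoint_smooth w : smooth_on A (fun z => adjoint G H f z w).
Proof.
move=> k; rewrite (_ : (fun z => _) = (fun z => w *m D z)).
  by apply: Ck_mulmx => //; exact: Ck_cst.
by apply/funext => z; exact: adjE.
Qed.

Let dD : differentiable D y.
Proof. exact: smooth_diff DC Ay. Qed.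

Let D2 (u v : 'rV[R]_m) : 'rV[R]_n := v *m 'D_u (fun z => 'J f z) y.

Let D2b : bilin D2.
Proof.
split=> [t u u' v|t u v v']; rewrite /D2; last by rewrite mulmxDl -scalemxAl.
by rewrite (derive_dirP t u u' djf) mulmxDr -scalemxAr.
Qed.

Let D2E u v : 'D_u (fun z => 'd f z v) y = D2 u v.
Proof.
rewrite /D2 -(derive_mulmxl v u djf); congr ('D_u _ y).
by apply/funext => z; rewrite diff_jacobian.
Qed.

Let D2DD u v : D2 u v = 'D_u ('D_v f) y.
Proof.
rewrite -D2E; apply: (open_eq_derive _ oA Ay) => z; rewrite inE => Az.
exact: esym (deriveE v (smooth_diff fC Az)).
Qed.

Let D2_sym u v : D2 u v = D2 v u.
Proof. by rewrite !D2DD; exact: derive_sym_mx oA Ay (fC 2). Qed.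

Let GH u v := christoffel H (f y) u v.
Let GHb : bilin GH. Proof. exact: christoffel_bilin. Qed.
Let GH_sym u v : GH u v = GH v u.
Proof. exact: (christoffel_sym dH oB By Hsym). Qed.

Let GG u v := christoffel G y u v.
Let GGb : bilin GG. Proof. exact: christoffel_bilin. Qed.
Let GG_sym u v : GG u v = GG v u.
Proof. exact: (christoffel_sym dG oA Ay Gsym). Qed.

Let ndf u v : 'rV[R]_n := D2 u v + GH (u *m F) (v *m F) - GG u v *m F.

Let ndfE u v : second_fund G H f (fun=> u) (fun=> v) y = ndf u v.
Proof.
rewrite /second_fund /cov_along /cov D2E derive_cst add0r.
by rewrite /ndf !(diff_jacobian f y).
Qed.

Let ndf_sym u v : ndf u v = ndf v u.
Proof. by rewrite /ndf D2_sym GH_sym GG_sym. Qed.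

Let ndfb : bilin ndf.
Proof.
have [Dl Dr] := D2b; have [Hl Hr] := bilin_comp F GHb.
have [Gl Gr] := bilin_mulmxr F GGb.
have E (a a' b b' c c' : 'rV[R]_n) t : (t *: a + a') + (t *: b + b') - (t *: c
  + c')
    = t *: (a + b - c) + (a' + b' - c').
  by apply/rowP => i; rewrite !mxE; ring.
split=> [t u u' v|t u v v']; rewrite /ndf.
  by rewrite Dl Hl Gl E.
by rewrite Dr Hr Gr E.
Qed.

Let tensionE : tension G H f y = contract (invmx (G y)) ndf.
Proof. by rewrite /tension gtraceE; apply: eq_contract => u v; exact: ndfE. Qed.

(** The tensor [ndf] evaluated on a nonconstant field. This is needed for the adjoint fields, on
    which PHH is stated. *)
Let ndf_field (Z : 'rV[R]_m -> 'rV[R]_m) x : differentiable Z y ->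
  ndf x (Z y) = 'D_x (fun z => Z z *m 'J f z) y + GH (x *m F) (Z y *m F)
    - cov G Z y x *m F.
Proof.
move=> dZ; rewrite (derive_mulmx x dZ djf) /cov -/(GG x (Z y)) /ndf /D2.
rewrite mulmxDl -/F.
by apply/rowP => i; rewrite !mxE; ring.
Qed.

Let phwcE z (w : 'rV[R]_n) : A z -> w *m J (f z) *m D z *m 'J f z = w *m D z *m
  'J f z *m J (f z).
Proof. by move=> Az; have := fphwc Az w;
  rewrite !adjE !(diff_jacobian f z). Qed.

Let kahler_cst (w v : 'rV[R]_n) : w *m 'D_v J (f y) + GH v (w *m J (f y)) = GH
  v w *m J (f y).
Proof.
have := JK By w v; rewrite /cov derive_cst add0r => <-; congr (_ + _).
by rewrite (derive_mulmxl w v dJ).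
Qed.

Let phhE (w w' : 'rV[R]_n) :
  cov G (fun z => w' *m J (f z) *m D z) y (w *m D y) *m F
  = cov G (fun z => w' *m D z) y (w *m D y) *m F *m J (f y).
Proof.
have adjF : adjoint G H f = (fun z w => w *m D z).
  by apply/funext => z; apply/funext => u; exact: adjE.
have := fphh w w'; rewrite adjF => e;
  apply: (etrans (esym (diff_jacobian f y _))).
exact: etrans e (congr1 (mulmx ^~ _) (diff_jacobian f y _)).
Qed.

(** By PHWC [J] passes through [df] composed with its adjoint along [A]. Differentiating that
    identity, the Kähler condition treats the term in the pulled-back connection and PHH the other
    one. *)
Let ndfJ (w w' : 'rV[R]_n) : ndf (w *m D y) (w' *m J (f y) *m D y)
  = ndf (w *m D y) (w' *m D y) *m J (f y).
Proof.
set x := w *m D y.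
have dJf : differentiable (fun z => J (f z)) y by exact: differentiable_comp.
have dwD : differentiable (fun z => w' *m D z) y.
  by apply: differentiable_mulmx => //; exact: differentiable_cst.
have dwJ : differentiable (fun z => w' *m J (f z)) y.
  by apply: differentiable_mulmx => //; exact: differentiable_cst.
have dwJD : differentiable (fun z => w' *m J (f z) *m D z) y.
  exact: differentiable_mulmx.
have dU : differentiable (fun z => w' *m D z *m 'J f z) y.
  exact: differentiable_mulmx.
have DJf : 'D_x (fun z => J (f z)) y = 'D_(x *m F) J (f y).
  by rewrite (derive_comp x df dJ) (deriveE x df) diff_jacobian deriveE.
have DU : 'D_x (fun z => w' *m J (f z) *m D z *m 'J f z) y =
    'D_x (fun z => w' *m D z *m 'J f z) y *m J (f y)
    + w' *m D y *m F *m 'D_(x *m F) J (f y).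
  rewrite -DJf -(derive_mulmx x dU dJf); apply: (open_eq_derive _ oA Ay) => z.
  by rewrite inE => Az; exact: phwcE.
have K := kahler_cst (w' *m D y *m F) (x *m F).
have e : w' *m J (f y) *m D y *m F = w' *m D y *m F *m J (f y) by exact: phwcE.
apply: (etrans (ndf_field x dwJD)); apply: esym.
apply: (etrans (congr1 (mulmx ^~ (J (f y))) (ndf_field x dwD))).
rewrite /= mulmxBl mulmxDl -K addrA -DU -e.
by congr (_ - _); rewrite -phhE.
Qed.

Let beta (w w' : 'rV[R]_n) := ndf (w *m D y) (w' *m D y).

Let beta_bilin : bilin beta.
Proof.
exact: bilin_comp ndfb.
Qed.

(** Complex linearity in the second argument, and in the first by symmetry, makes the two factors
    [J] multiply to -1. *)
Let betaJ (w w' : 'rV[R]_n) : beta (w *m J (f y)) (w' *m J (f y)) = - beta w w'.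
Proof.
rewrite /beta ndfJ ndf_sym ndfJ -mulmxA (JJ By) mulmxN mulmx1 ndf_sym.
by [].
Qed.

Let k := (m - (n - r))%N.
Hypotheses (rn : (r <= n)%N) (yT : y *m copid_mx k = 0).
Hypothesis fT : forall z, A z -> z *m copid_mx k = 0 -> f z *m copid_mx r = 0.
Hypothesis JT : forall z, B z -> z *m copid_mx r = 0 ->
  forall w : 'rV_n, w *m copid_mx r = 0 -> w *m J z *m copid_mx r = 0.

Let km : (k <= m)%N. Proof. exact: leq_subr. Qed.
Let E : 'M[R]_(k, m) := pid_mx k.
Let E' : 'M[R]_(r, n) := pid_mx r.

Let EK : E *m E^T = 1%:M.
Proof. by rewrite tr_pid_mx mul_pid_mx minnn (minn_idPr km) pid_mx_1. Qed.

Let E'K : E' *m E'^T = 1%:M.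
Proof. by rewrite tr_pid_mx mul_pid_mx minnn (minn_idPr rn) pid_mx_1. Qed.

Let ET (u : 'rV_k) : u *m E *m copid_mx k = 0.
Proof. by rewrite -mulmxA mul_pid_mx_copid// mulmx0. Qed.

Let E'T (u : 'rV_r) : u *m E' *m copid_mx r = 0.
Proof. by rewrite -mulmxA mul_pid_mx_copid// mulmx0. Qed.

Let lineT q l (z v : 'rV[R]_q) (t : R) :
  z *m copid_mx l = 0 -> v *m copid_mx l = 0 -> (t *: v + z) *m copid_mx l = 0.
Proof. by move=> zT vT; rewrite mulmxDl -scalemxAl vT zT scaler0 addr0. Qed.

Let dfT z (v : 'rV[R]_m) : A z -> z *m copid_mx k = 0 -> v *m copid_mx k = 0 ->
  'D_v f z *m copid_mx r = 0.
Proof.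
move=> Az zT vT; have dfz : differentiable f z by exact: smooth_diff fC Az.
rewrite -(derive_mulmxr (copid_mx r) v dfz).
apply: (derive_along_eq0 oA Az) => [|t At].
  by apply: differentiable_mulmx => //; exact: differentiable_cst.
by apply: fT => //; exact: lineT.
Qed.

Let FT (v : 'rV[R]_m) : v *m copid_mx k = 0 -> v *m F *m copid_mx r = 0.
Proof. by move=> vT; rewrite -deriveEjacobian//; exact: dfT. Qed.

(** At points of the slice ['D_v f] is already tangent to [P], a linear condition that survives a
    second differentiation along the slice. *)
Let D2T (u v : 'rV[R]_m) : u *m copid_mx k = 0 -> v *m copid_mx k = 0 ->
  D2 u v *m copid_mx r = 0.
Proof.
move=> uT vT; have DvC := smooth_derive v fC.
have dDv : differentiable ('D_v f) y by exact: smooth_diff DvC Ay.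
rewrite D2DD -(derive_mulmxr (copid_mx r) u dDv).
apply: (derive_along_eq0 oA Ay) => [|t At].
  by apply: differentiable_mulmx => //; exact: differentiable_cst.
by apply: dfT => //; exact: lineT.
Qed.

(** [J] preserves the constant subspace of tangent vectors at every point of the slice [P], so its
    derivative along [P] does too. *)
Let DJT (w v : 'rV[R]_n) : w *m copid_mx r = 0 -> v *m copid_mx r = 0 ->
  w *m 'D_v J (f y) *m copid_mx r = 0.
Proof.
move=> wT vT; have dwJ : differentiable (fun z => w *m J z) (f y).
  by apply: differentiable_mulmx => //; exact: differentiable_cst.
rewrite -(derive_mulmxl w v dJ) -(derive_mulmxr (copid_mx r) v dwJ).
apply: (derive_along_eq0 oB By) => [|t Bt].
  by apply: differentiable_mulmx => //; exact: differentiable_cst.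
by apply: JT => //; apply: lineT => //; exact: fT.
Qed.

(* The second fundamental form of [P] is complex linear in each argument. *)
Let GHJ (w v : 'rV[R]_n) : w *m copid_mx r = 0 -> v *m copid_mx r = 0 ->
  GH v (w *m J (f y)) *m copid_mx r = GH v w *m J (f y) *m copid_mx r.
Proof.
by move=> wT vT; rewrite -kahler_cst mulmxDl (DJT wT vT) add0r.
Qed.

Let GHJJ (w v : 'rV[R]_n) : w *m copid_mx r = 0 -> v *m copid_mx r = 0 ->
  GH (w *m J (f y)) (v *m J (f y)) *m copid_mx r = - (GH w v *m copid_mx r).
Proof.
move=> wT vT; have fyT : f y *m copid_mx r = 0 by exact: fT.
have wJT := JT By fyT wT.
rewrite (GHJ vT wJT) GH_sym.
(* Complex linearity holds only modulo tangent vectors; since [J] preserves these, it can be applied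
   once more. *)
have tT : (GH v (w *m J (f y)) - GH v w *m J (f y)) *m copid_mx r = 0.
  by rewrite mulmxBl (GHJ wT vT) subrr.
have := JT By fyT tT; rewrite !mulmxBl => /eqP; rewrite subr_eq0 => /eqP ->.
by rewrite -(mulmxA _ (J (f y)) (J (f y))) (JJ By) mulmxN mulmx1 mulNmx GH_sym.
Qed.

(** The tangent space of [K] lies in the kernel of [F *m copid_mx r], and the dimensions agree
    because [F] is surjective. *)
Let tangentP (v : 'rV[R]_m) : (v *m F <= E')%MS -> (v <= E)%MS.
Proof.
move=> /submxP[u vE].
pose C := F *m copid_mx r.
have CE : (C :=: (copid_mx r : 'M[R]_n))%MS by exact: eqmxMfull.
have EC : (E <= kermx C)%MS.
  apply/sub_kermxP/row_matrixP => i; rewrite row0 row_mul mulmxA.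
  by apply: FT; rewrite rowE ET.
have rk : \rank (kermx C) = k by rewrite mxrank_ker CE rank_copid_mx.
have [_] := mxrank_leqif_sup EC; rewrite rk rank_pid_mx// eqxx => /esym sCE.
apply: submx_trans sCE; apply/sub_kermxP.
by rewrite /C mulmxA vE E'T.
Qed.

Variable v0 : 'rV[R]_m.
Hypothesis harm : tension G H f y + v0 *m F = 0.

Let Hu : H (f y) \in unitmx.
Proof. by apply: posdef_unitmx; exact: Hpos. Qed.

Let GT : (G y)^T = G y.
Proof. exact: ip_sym_trmx (Gsym Ay). Qed.

Let HT : (H (f y))^T = H (f y).
Proof. exact: ip_sym_trmx (Hsym By). Qed.

Let JHJm : J (f y) *m H (f y) *m (J (f y))^T = H (f y).
Proof.
apply: ip_inj => u v; rewrite -(JHJ By u v) /ip trmx_mul.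
by rewrite !mulmxA.
Qed.

Let Gku : E *m G y *m E^T \in unitmx.
Proof.
apply: posdef_unitmx => u u0.
have -> : ip (E *m G y *m E^T) u u = ip (G y) (u *m E) (u *m E).
  by rewrite /ip trmx_mul !mulmxA.
apply: Gpos => //; apply: contraNneq u0 => uE.
by rewrite -[u]mulmx1 -EK mulmxA uE mul0mx.
Qed.

Let Ga := F^T *m invmx (G y) *m F.

(** [w *m Ga *m w^T] is the squared norm of [w *m F^T *m invmx (G y)], which vanishes only for
    [w = 0] as [F] is surjective. *)
Let Gau : Ga \in unitmx.
Proof.
apply: injective_unitmx => w wGa; set x := w *m F^T *m invmx (G y).
have x0 : x = 0.
  apply/eqP/contraT => /(Gpos Ay); rewrite /ip.
  have -> : x *m G y *m x^T = w *m Ga *m w^T.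
    rewrite {1}/x mulmxKV ?Gu// /x !trmx_mul trmxK trmx_inv GT.
    by rewrite /Ga !mulmxA.
  by rewrite wGa mul0mx mxE ltxx.
have wF : w *m F^T = 0 by rewrite -[LHS](mulmxKV (Gu Ay)) -/x x0 mul0mx.
have [F' FK] := row_fullP ffull.
have FK' : F^T *m F'^T = 1%:M by rewrite -trmx_mul FK trmx1.
by rewrite -[w]mulmx1 -FK' mulmxA wF mul0mx.
Qed.

Let JP : J (f y) *m (H (f y) *m Ga) = H (f y) *m Ga *m J (f y).
Proof.
have -> : H (f y) *m Ga = D y *m F by rewrite /Ga /D !mulmxA.
apply/row_matrixP => i; rewrite !rowE; have := phwcE (delta_mx 0 i) Ay.
rewrite -/F; move: (D y) (J (f y)) F => D1 J1 F1.
by rewrite -!mulmxA.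
Qed.

(** The contraction stands for the trace of the second fundamental form of [K], up to the tangent
    vector found in [tension_incl]. *)
Lemma local_normal_part :
  (contract (E^T *m invmx (E *m G y *m E^T) *m E) (christoffel G y) - v0)
    *m copid_mx k = 0.
Proof.
have fyT : f y *m copid_mx r = 0 by exact: fT.
have [Phi EF] : exists Phi, E *m F = Phi *m E'.
  apply/(pid_copidP _ rn)/row_matrixP => i; rewrite row0 row_mul.
  by rewrite row_mul; apply: FT; rewrite rowE ET.
have [J' E'J] : exists J', E' *m J (f y) = J' *m E'.
  apply/(pid_copidP _ rn)/row_matrixP => i; rewrite row0 row_mul.
  by rewrite row_mul; apply: JT => //; rewrite rowE E'T.
have [T TJ TE] := normal_cometric (Gu Ay) Hu Gku GT HT (JJ By) JHJm E'K Gau JP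
  EF E'J tangentP.
have sJ := sigma0_invariant (Gu Ay) Hu Gku (JJ By) JHJm E'K Gau JP EF E'J
  tangentP.
have sE := sigmaE (G y) EF.
set S := E^T *m _ *m E in TE sE *; set s0 := Phi^T *m _ *m Phi in sJ sE.
(* The normal part vanishes by PHH, so harmonicity determines the contraction over the tangent space
   of [K] alone. *)
have cN : contract (invmx (G y) - S) ndf = 0.
  have -> : invmx (G y) - S = (D y)^T *m T *m D y by exact: TE.
  apply: (etrans (contract_congr T (D y) ndfb)).
  exact: (contract_anti beta_bilin TJ betaJ).
have cS : contract S ndf = - (v0 *m F).
  have e : contract (invmx (G y)) ndf = contract S ndf.
    by rewrite -[invmx (G y)](subrK S) contractDl cN add0r.
  by apply/eqP; rewrite -addr_eq0 -e -tensionE harm.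
have cSE : contract S ndf =
    contract S D2 + contract S (fun u v => GH (u *m F) (v *m F)) - contract S
      GG *m F.
  by rewrite -contract_mul -contractN -!contractD.
(* [S] is supported on the tangent space of [K], where second derivatives of [f] are tangent to
   [P]. *)
have D20 : contract S D2 *m copid_mx r = 0.
  rewrite -contract_mul (contract_congr _ E (bilin_mulmxr _ D2b)).
  rewrite /contract big1// => i _; rewrite big1// => j _.
  by rewrite D2T ?ET// scaler0.
(* Pushed forward by [F], [S] becomes a complex-invariant tensor on the tangent space of [P], where
   the second fundamental form changes sign. *)
have GH0 : contract S (fun u v => GH (u *m F) (v *m F)) *m copid_mx r = 0.
  rewrite -(contract_congr S F GHb) sE (contract_congr s0 E' GHb) -contract_mul.
  apply: (contract_anti (bilin_mulmxr _ (bilin_comp E' GHb)) sJ).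
  move=> u v; rewrite -!(mulmxA _ J') -E'J !mulmxA.
  by apply: GHJJ; exact: E'T.
set X := _ - v0.
have XF : X *m F *m copid_mx r = 0.
  have eX : contract S GG *m F - v0 *m F =
      contract S D2 + contract S (fun u v => GH (u *m F) (v *m F)).
    have abel (a b v : 'rV[R]_n) : a - b = - v -> b - v = a.
      by move=> <-; rewrite addrC subrK.
    by apply: abel; exact: etrans (esym cSE) cS.
  by rewrite /X mulmxBl eX mulmxDl D20 GH0 addr0.
have /tangentP/submxP[u ->] : (X *m F <= E')%MS.
  by have /(pid_copidP _ rn)[u ->] := XF; exact: submxMl.
exact: ET.
Qed.

End LocalEquation.

(** * The inclusion of a coordinate slice *)

Section Inclusion.
Variables (R : realType) (k m : nat).

Lemma differentiable_incl u : differentiable (@Defs.incl R m k) u.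
Proof.
apply: (@linear_differentiable _ _ _ (mulmxr (pid_mx k))).
exact: mx_linear_continuous.
Qed.

Lemma diff_incl u v : 'd (@Defs.incl R m k) u v = v *m pid_mx k.
Proof.
rewrite (@diff_lin _ _ _ (mulmxr (pid_mx k)))//.
exact: mx_linear_continuous.
Qed.

(** The inclusion is linear, so its second derivative drops out; the Christoffel term of the induced
    metric contributes only the tangent vector [w *m E]. *)
Lemma tension_incl (G : 'rV[R]_m -> 'M[R]_m) (u : 'rV[R]_k) :
  differentiable G (Defs.incl m u) ->
  let E : 'M[R]_(k, m) := pid_mx k in
  exists w : 'rV_k,
  tension (induced_metric G (@Defs.incl R m k)) G (@Defs.incl R m k) u =
  contract (E^T *m invmx (E *m G (Defs.incl m u) *m E^T) *m E)
    (christoffel G (Defs.incl m u)) - w *m E.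
Proof.
move=> dG E.
have JE : 'J (@Defs.incl R m k) u = E.
  apply: jacobian_eq => [|v]; first exact: differentiable_incl.
  by rewrite deriveE ?diff_incl//; exact: differentiable_incl.
set Gk := induced_metric G _.
have GkE : Gk u = E *m G (Defs.incl m u) *m E^T by rewrite /Gk /induced_metric
  JE.
exists (contract (invmx (Gk u)) (christoffel Gk u)).
rewrite (contract_congr _ E (christoffel_bilin dG)) -GkE.
rewrite -contract_mul -contractN -contractD /tension gtraceE.
apply: eq_contract => a b.
have D0 : 'D_a (fun z => 'd (@Defs.incl R m k) z b) u = 0.
  rewrite (_ : (fun z => _) = cst (b *m pid_mx k)); first exact: derive_cst.
  by apply/funext => z; rewrite diff_incl.
rewrite /second_fund /cov_along /cov D0 (derive_cst b u a) !add0r.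
by rewrite !(diff_incl u).
Qed.

End Inclusion.

(** * Passage from the local equation to slice charts of the preimage *)

Theorem theorem3p7 (R : realType) (m n p : nat)
    (M : manifold R m) (N : manifold R (2 * n))
    (g : metric M) (J : acstruct N) (h : metric N) (V : vfield M)
    (phi : M -> N) (P : set N) :
  kahler J h ->
  submersion phi ->
  PHH g J h phi ->
  V_harmonic g h V phi ->
  complex_submanifold J (2 * p) P ->
  exists k : nat, V_minimal g V k (phi @^-1` P).
Proof.
move=> kah sub [phwc phh] [_ harm] [subP cplxP].
(* The preimage has the same codimension [2 * n - 2 * p] as [P]. *)
exists (m - (2 * n - 2 * p))%N; split; first exact: submersion_preimage.
move=> c [ac km cK] u cu.
have [[phic phiC] phiS] := sub.
have [x cx xu] := cu.
have Px : P (phi x) by apply/(cK x cx); exists u.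
have [d sd dx] := subP _ Px; have [ad pn dP] := sd.
pose f := rep phi c d; pose A := rep_dom phi c d.
have oA : open A by exact: rep_dom_open.
have Ay : A (Defs.incl m u) by exists x.
have Ac : A `<=` cimg c by move=> z [x' [cx' _] <-]; exists x'.
have fAB z : A z -> cimg d (f z).
  by move=> [x' [cx' dx'] <-]; exists (phi x') => //; rewrite /f rep_in_slice.
have GC : smooth_on A (g c) by move=> j;
  exact: Ck_sub Ac (metric_smooth g ac j).
have HC : smooth_on (cimg d) (h d) := metric_smooth h ad.
have JC : smooth_on (cimg d) (J d) := acs_smooth J ad.
have fC : smooth_on A f := phiC c d ac ad.
have Gs z : A z -> forall a b, ip (g c z) a b = ip (g c z) b a.
  by move=> /Ac cz; exact: (Defs.metric_sym g ac cz).
have Gp z : A z -> forall a, a != 0 -> 0 < ip (g c z) a a.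
  by move=> /Ac cz; exact: (metric_pos g ac cz).
have [JHJ JK] := kah d ad.
have full : row_full ('J f (Defs.incl m u)).
  apply: surj_row_full => w; have [v vw] := phiS c d ac ad _ Ay w.
  by exists v; rewrite -diff_jacobian.
have JK' z : cimg d z -> forall w v,
    cov (h d) (fun z' => w *m J d z') z v = cov (h d) (fun=> w) z v *m J d z.
  move=> dz w v; apply: (JK (cimg d) (fun=> w)) => //; first exact: cimg_open.
  by move=> j; exact: Ck_cst.
have fphwc z : A z -> forall w,
    'd f z (adjoint (g c) (h d) f z (w *m J d (f z)))
    = 'd f z (adjoint (g c) (h d) f z w) *m J d (f z).
  by move=> Az; exact: (phwc.2 c d ac ad z Az).
have fphh w w' : 'd f (Defs.incl m u) (cov (g c)
      (fun z => adjoint (g c) (h d) f z (w' *m J d (f z))) (Defs.incl m u)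
      (adjoint (g c) (h d) f (Defs.incl m u) w))
    = 'd f (Defs.incl m u) (cov (g c) (fun z => adjoint (g c) (h d) f z w')
      (Defs.incl m u)
      (adjoint (g c) (h d) f (Defs.incl m u) w)) *m J d (f (Defs.incl m u)).
  (* PHH is used with a constant field on the target and, on the source, the adjoint of a constant
     field, which is horizontal by [adjointP]. *)
  apply: (phh c d ac ad A (cimg d) (fun z => adjoint (g c) (h d) f z w)
    (fun=> w')) => //.
  - exact: cimg_open.
  - by move=> _ [z Az <-]; exact: fAB.
  - exact: (adjoint_smooth oA fAB GC HC fC Gp).
  - move=> z Az v vf; rewrite adjointP; last by apply: posdef_unitmx; exact: Gp.
    by rewrite vf /ip trmx0 mulmx0 mxE.
  - by move=> j; exact: Ck_cst.
have fT z : A z -> z *m copid_mx (m - (2 * n - 2 * p))%N = 0 ->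
    f z *m copid_mx (2 * p)%N = 0.
  move=> [x' [cx' dx'] <-] /(pid_copidP _ km) xT.
  by rewrite /f rep_in_slice//; apply/(pid_copidP _ pn)/(dP _ dx')/(cK x' cx').
have JT z : cimg d z -> z *m copid_mx (2 * p)%N = 0 -> forall w : 'rV_(2 * n),
    w *m copid_mx (2 * p)%N = 0 -> w *m J d z *m copid_mx (2 * p)%N = 0.
  move=> dz /(pid_copidP _ pn)[b zb] w /(pid_copidP _ pn)[a ->].
  rewrite zb in dz *; have [a' aE] := cplxP d sd b dz a.
  apply/(pid_copidP _ pn); exists a'; move: aE.
  by rewrite !(diff_incl _ b).
have uT : (Defs.incl m u) *m copid_mx (m - (2 * n - 2 * p))%N = 0.
  by apply/(pid_copidP _ km); exists u.
have harmf : tension (g c) (h d) f (Defs.incl m u) + V c (Defs.incl m u) *m 'J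
  f (Defs.incl m u) = 0.
  by rewrite -diff_jacobian; exact: harm.
have := local_normal_part oA (cimg_open (c := d)) Ay fAB GC HC JC fC Gs Gp
  (Defs.metric_sym h ad) (metric_pos h ad) (acs_sqr J ad) JHJ JK' fphwc fphh
    full
  pn uT fT JT harmf.
have [w0 ->] := tension_incl (smooth_diff GC Ay).
set X := contract _ _ => XT.
have /(pid_copidP _ km)[w wE] : (X - w0 *m pid_mx (m - (2 * n - 2 * p))%N
    - V c (Defs.incl m u)) *m copid_mx (m - (2 * n - 2 * p))%N = 0.
  rewrite addrAC mulmxBl XT sub0r -mulmxA mul_pid_mx_copid//.
  by rewrite mulmx0 oppr0.
by exists w; rewrite wE diff_incl.
Qed.
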